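(* For any non-computable set $A \leq_T \emptyset'$, there exists a $\emptyset'$-computable perfect tree $T \subseteq 2^{<\omega}$ such that for all $S \in [T]$ and all $R \subseteq \omega$, if $R$ is $2$-random then $S \oplus R \not\geq_T A$.
   Context: A tree $T \subseteq 2^{<\omega}$ is perfect if every node has two incomparable extensions in $T$; $[T]$ is its set of infinite paths. $S \oplus R = \{2n : n \in S\} \cup \{2n+1 : n \in R\}$. A set $R$ is $2$-random if it is Martin-Löf random relative to $\emptyset'$, i.e., it passes every Martin-Löf test relative to $\emptyset'$ (every uniformly $\emptyset'$-c.e. sequence of open sets $U_i$ with $\mu(U_i) \leq 2^{-i}$ for the uniform measure $\mu$ has $R \notin \bigcap_i U_i$). *)

(* Defs.v *)
From HB Require Import structures.
From Stdlib Require Import Cantor.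
From mathcomp Require Import all_boot all_order all_algebra.
From mathcomp Require Import all_classical all_reals all_analysis.
From mathcomp Require Import zify lra.
Import Order.TTheory GRing.Theory Num.Theory.

Set Implicit Arguments.
Unset Strict Implicit.
Unset Printing Implicit Defensive.

Local Open Scope classical_set_scope.
Local Open Scope nat_scope.

(** Subsets of omega, equivalently points of Cantor space, are represented by
    their characteristic functions [nat -> bool]. *)

(** * Oracle computability

    Unary partial functions computable from an oracle, generated from the
    basic functions, the projections of the Cantor pairing and the oracle by
    pairing, composition, primitive recursion and unbounded minimization. *)

Definition npair (a b : nat) : nat := Cantor.to_nat (a, b).

Inductive code : Type :=
  | Zero
  | Succ
  | Left
  | Right
  | Oracle
  | Pair of code & code
  | Comp of code & code
  | Prec of code & code
  | Mu of code.

(** Graph of the function h with h(a, 0) = F(a) and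
    h(a, n+1) = G(a, (n, h(a, n))). *)
Fixpoint prec_graph (F G : nat -> nat -> Prop) (a n y : nat) : Prop :=
  if n is m.+1 then
    exists2 z, prec_graph F G a m z & G (npair a (npair m z)) y
  else F a y.

(** [eval X c n y]: the program [c] with oracle [X] halts on input [n] with
    output [y]. *)
Fixpoint eval (X : nat -> bool) (c : code) (n y : nat) : Prop :=
  match c with
  | Zero => y = 0
  | Succ => y = n.+1
  | Left => y = (Cantor.of_nat n).1
  | Right => y = (Cantor.of_nat n).2
  | Oracle => y = X n
  | Pair f g =>
      exists a b, [/\ eval X f n a, eval X g n b & y = npair a b]
  | Comp f g => exists2 z, eval X g n z & eval X f z y
  | Prec f g =>
      prec_graph (eval X f) (eval X g) (Cantor.of_nat n).1
        (Cantor.of_nat n).2 y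
  | Mu f =>
      eval X f (npair n y) 0 /\
      forall k, k < y -> exists v, eval X f (npair n k) v.+1
  end.

Lemma eval_functional X c n y y' : eval X c n y -> eval X c n y' -> y = y'.
Proof.
elim: c n y y' => [|||||f IHf g IHg|f IHf g IHg|f IHf g IHg|f IHf] n y y' /=.
1-5: by move=> -> ->.
- move=> [a [b [fa gb ->]]] [a' [b' [fa' gb' ->]]].
  by rewrite (IHf _ _ _ fa fa') (IHg _ _ _ gb gb').
- by move=> [z gz fy] [z' gz']; rewrite -(IHg _ _ _ gz gz'); exact: IHf.
- elim: (Cantor.of_nat n).2 y y' => [|m IHm] y y' /=; first exact: IHf.
  by move=> [z Pz gy] [z' Pz']; rewrite -(IHm _ _ Pz Pz'); exact: IHg.
- move=> [fy ylt] [fy' ylt']; case: (ltngtP y y') => // yy'.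
  + by have [v fv] := ylt' _ yy'; have := IHf _ _ _ fy fv.
  + by have [v fv] := ylt _ yy'; have := IHf _ _ _ fy' fv.
Qed.

(** Gödel number of a program. *)
Fixpoint encode (c : code) : nat :=
  match c with
  | Zero => npair 0 0
  | Succ => npair 1 0
  | Left => npair 2 0
  | Right => npair 3 0
  | Oracle => npair 4 0
  | Pair f g => npair 5 (npair (encode f) (encode g))
  | Comp f g => npair 6 (npair (encode f) (encode g))
  | Prec f g => npair 7 (npair (encode f) (encode g))
  | Mu f => npair 8 (encode f)
  end.

Lemma npair_inj a b a' b' : npair a b = npair a' b' -> a = a' /\ b = b'.
Proof. by move=> /Cantor.to_nat_inj[-> ->]. Qed.

Lemma encode_inj : injective encode.
Proof.
elim=> [|||||f IHf g IHg|f IHf g IHg|f IHf g IHg|f IHf]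
  [|||||f' g'|f' g'|f' g'|f'] //= /npair_inj[// _].
1-3: by move=> /npair_inj[/IHf-> /IHg->].
by move=> /IHf->.
Qed.

Definition emptyset : nat -> bool := fun=> false.

(** The Turing jump X': numbers of the programs that halt, with oracle X, on
    their own number. *)
Definition jump (X : nat -> bool) : nat -> bool :=
  fun n => `[< exists c, n = encode c /\ exists y, eval X c n y >].

Definition turing_le (A B : nat -> bool) : Prop :=
  exists c, forall n, eval B c n (A n).

Definition computable (A : nat -> bool) : Prop := turing_le A emptyset.

(** W is c.e. in X: the domain of a function partial computable in X. *)
Definition ce_in (X : nat -> bool) (W : set nat) : Prop :=
  exists c, forall n, W n <-> exists y, eval X c n y.

Definition join (S R : nat -> bool) : nat -> bool :=
  fun n => if odd n then R n./2 else S n./2.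

(** * Binary strings and trees *)

(** Bijective base-2 numbering of the finite binary strings. *)
Definition str_code : seq bool -> nat :=
  foldr (fun (b : bool) k => k.*2 + b.+1) 0.

Lemma str_code_bij : bijective str_code.
Proof.
have str_code_inj : injective str_code.
  elim=> [|b s IHs] [|b' s'] //= e; try by lia.
  have [eb es] : b = b' /\ str_code s = str_code s'.
    by case: b b' e => [] [] /=; lia.
  by rewrite eb (IHs _ es).
have str_code_surj n : exists s, str_code s = n.
  elim/ltn_ind: n => -[_|n IHn]; first by exists [::].
  have ltn2 : n./2 < n.+1 by lia.
  have [s es] := IHn _ ltn2.
  by exists (odd n :: s) => /=; rewrite es; lia.
pose g n := sval (cid (str_code_surj n)).
have gK n : str_code (g n) = n by rewrite /g; case: cid.
apply: (Bijective (g := g) _ gK) => s.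
exact: (str_code_inj _ _ (gK (str_code s))).
Qed.

(** A set of strings decidable from the oracle X. *)
Definition strings_computable_in (X : nat -> bool) (T : pred (seq bool)) : Prop :=
  exists c, forall s, eval X c (str_code s) (T s).

(** The first conjunct excludes the empty tree. *)
Definition is_tree (T : pred (seq bool)) : Prop :=
  T [::] /\ forall s t, prefix s t -> T t -> T s.

Definition perfect_tree (T : pred (seq bool)) : Prop :=
  is_tree T /\
  forall s, T s -> exists t u,
    [/\ T t, T u, prefix s t, prefix s u & ~~ prefix t u && ~~ prefix u t].

Definition paths (T : pred (seq bool)) : set (nat -> bool) :=
  [set S | forall n, T (mkseq S n)].

(** * The uniform measure on Cantor space *)

Definition cylinder (s : seq bool) : set (nat -> bool) :=
  [set X | mkseq X (size s) = s].

Definition cantor : Type := g_sigma_algebraType (range cylinder).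
HB.instance Definition _ := Measurable.on cantor.

Section uniform_measure.
Variable K : realType.
Local Open Scope ring_scope.

(** The binary expansion of x in [0, 1[, most significant digit first. *)
Definition binary_expansion (x : measurableTypeR K) : cantor :=
  fun n => odd (Num.truncn (2 ^+ n.+1 * x)).

Lemma measurable_unit_itv : measurable (`[0, 1[%classic : set (measurableTypeR K)).
Proof. exact: measurable_itv. Qed.

(** The law of the binary expansion of a uniformly distributed real number;
    [uniform_measure_cylinder] below characterizes it. *)
Definition uniform_measure : set cantor -> \bar K :=
  pushforward (mrestr lebesgue_measure measurable_unit_itv) binary_expansion.

Lemma measurable_binary_expansion : measurable_fun setT binary_expansion.
Proof.
have mtrunc (a : K) (k : nat) : 0 < a ->
    measurable ([set x | Num.truncn (a * x) = k] : set (measurableTypeR K)).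
  move=> a0; case: k => [|k].
    rewrite (_ : [set _ | _] = `]-oo, a^-1[%classic); first exact: measurable_itv.
    apply/seteqP; split => x /=; rewrite in_itv /=.
      move/eqP; rewrite -leqn0 truncn_le_nat => h.
      by rewrite -ltr_pdivlMl// mulr1 in h.
    move=> h; apply/eqP; rewrite -leqn0 truncn_le_nat.
    by rewrite -ltr_pdivlMl// mulr1.
  rewrite (_ : [set _ | _] = `[a^-1 * k.+1%:R, a^-1 * k.+2%:R[%classic).
    exact: measurable_itv.
  apply/seteqP; split => x /=; rewrite in_itv /= ler_pdivrMl// ltr_pdivlMl//.
    move/eqP; rewrite eqn_leq truncn_gt_nat truncn_le_nat.
    by case/andP => -> ->.
  by move=> h; apply/eqP; rewrite eqn_leq truncn_gt_nat truncn_le_nat andbC.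
have mdigit n b :
    measurable ([set x | binary_expansion x n = b] : set (measurableTypeR K)).
  rewrite (_ : [set _ | _] = \bigcup_(k in [set k | odd k = b])
      [set x | Num.truncn (2 ^+ n.+1 * x) = k]).
    by apply: bigcup_measurable => k _; apply: mtrunc; rewrite exprn_gt0.
  apply/seteqP; split => x /=; first by move=> e; eexists; first exact: e.
  by move=> [k /= kb e]; rewrite /binary_expansion e.
apply: (@measurability _ _ _ cantor _ _ (range cylinder)) => // _ [_ [s _ <-] <-].
rewrite setTI (_ : _ @^-1` _ = \bigcap_(i in [set i | (i < size s)%N])
    [set x | binary_expansion x i = nth false s i]).
  by apply: bigcap_measurableType => i _; exact: mdigit.
apply/seteqP; split => x /=.
  by move=> e i /= lti; rewrite -[in RHS]e nth_mkseq.
move=> e; apply: (@eq_from_nth _ false); rewrite size_mkseq// => i lti.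
by rewrite nth_mkseq//; apply: e.
Qed.

Let uniform_measure0 : uniform_measure set0 = 0%E.
Proof. by rewrite /uniform_measure /pushforward preimage_set0 measure0. Qed.

Let uniform_measure_ge0 A : (0 <= uniform_measure A)%E.
Proof. by rewrite /uniform_measure /pushforward /mrestr; exact: measure_ge0. Qed.

Let uniform_measure_sigma_additive : semi_sigma_additive uniform_measure.
Proof.
exact: (@measure_semi_sigma_additive _ _ _
  (measure_function_pushforward__canonical__measure_function_Measure
    (mrestr lebesgue_measure measurable_unit_itv)
    measurable_binary_expansion)).
Qed.

HB.instance Definition _ := isMeasure.Build _ _ _ uniform_measure
  uniform_measure0 uniform_measure_ge0 uniform_measure_sigma_additive.

(** The number with binary digits s. *)
Let bin_val (s : seq bool) : nat :=
  foldl (fun k (b : bool) => (k.*2 + b)%N) 0%N s.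

Let bin_val_lt s : (bin_val s < 2 ^ size s)%N.
Proof.
elim/last_ind: s => [//|s b]; rewrite /bin_val foldl_rcons size_rcons expnS.
by move: (foldl _ _ s) => k; case: b; lia.
Qed.

Let truncn_double (y : K) : 0 <= y -> (Num.truncn (2 * y))./2 = Num.truncn y.
Proof.
move=> y0; have y20 : 0 <= 2 * y by rewrite mulr_ge0.
apply/esym/truncn_def; move: (truncn_itv y20).
set N := Num.truncn _ => /andP[le_N lt_N].
have eN : (N%:R : K) = 2 * (N./2)%:R + (odd N)%:R.
  by rewrite -natrM -natrD; congr (_%:R); lia.
move: le_N lt_N; rewrite -[N.+1%:R]natr1 -[(N./2).+1%:R]natr1 eN.
by case: (odd N) => /=; lra.
Qed.

Let binary_expansionP s (x : K) : 0 <= x < 1 ->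
  (mkseq (binary_expansion x) (size s) == s) =
  (Num.truncn (2 ^+ size s * x) == bin_val s).
Proof.
move=> /andP[x0 x1]; elim/last_ind: s => [|s b IHs].
  by rewrite /= expr0 mul1r eqxx; apply/esym/eqP/truncn_def; rewrite x0.
rewrite size_rcons mkseqS eqseq_rcons IHs /bin_val foldl_rcons -/(bin_val s).
rewrite /binary_expansion; set N := Num.truncn (2 ^+ (size s).+1 * x).
have <- : N./2 = Num.truncn (2 ^+ size s * x).
  by rewrite /N exprS -mulrA truncn_double// mulr_ge0// exprn_ge0.
by apply/andP/eqP => [[/eqP + /eqP]|->]; [lia|split; apply/eqP; case: (b); lia].
Qed.

Lemma uniform_measure_cylinder s :
  uniform_measure (cylinder s) = ((2 ^- size s)%:E : \bar K).
Proof.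
have p0 : 0 < 2 ^+ size s :> K by rewrite exprn_gt0.
have pE : 2 ^+ size s = (2 ^ size s)%N%:R :> K by rewrite natrX.
rewrite /uniform_measure /pushforward /mrestr.
pose v : K := (bin_val s)%:R.
rewrite (_ : _ `&` _ = `[(2 ^+ size s)^-1 * v, (2 ^+ size s)^-1 * (v + 1)[%classic).
  rewrite lebesgue_measure_itv /= lte_fin ltr_pM2l ?invr_gt0// ltrDl ltr01.
  by rewrite -EFinB -mulrBr addrC addKr mulr1.
apply/seteqP; split => x /=; rewrite !in_itv /= ler_pdivrMl// ltr_pdivlMl//.
  move=> [/eqP + x01]; rewrite binary_expansionP//.
  have x0 : 0 <= x by case/andP: x01.
  by rewrite truncn_eq ?mulr_ge0 ?(ltW p0)// -[(bin_val s).+1%:R]natr1.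
move=> /andP[vx xv].
have x0 : 0 <= x by rewrite -(pmulr_rge0 _ p0); apply: le_trans vx; exact: ler0n.
have x1 : x < 1.
  rewrite -(ltr_pM2l p0) mulr1; apply: lt_le_trans xv _.
  by rewrite /v natr1 pE ler_nat bin_val_lt.
split; last by rewrite x0 x1.
apply/eqP; rewrite binary_expansionP ?x0//; apply/eqP/truncn_def.
by rewrite vx -[(bin_val s).+1%:R]natr1.
Qed.

Let uniform_measure_setT : uniform_measure [set: cantor] = 1%:E.
Proof.
have := uniform_measure_cylinder [::].
rewrite expr0 invr1 => <-; congr (uniform_measure _).
by apply/seteqP; split => X.
Qed.

HB.instance Definition _ := Measure_isProbability.Build _ _ _
  uniform_measure uniform_measure_setT.

End uniform_measure.

(** * Martin-Löf randomness *)

(** [U] is a uniformly X-c.e. sequence of open subsets of Cantor space: the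
    [U i] are generated by the strings s with (i, s) in a single set c.e. in X. *)
Definition unif_ce_open (X : nat -> bool) (U : nat -> set cantor) : Prop :=
  exists2 W : set nat, ce_in X W &
    forall i, U i = \bigcup_(s in [set s | W (npair i (str_code s))]) cylinder s.

Definition martin_lof_test (K : realType) (X : nat -> bool)
    (U : nat -> set cantor) : Prop :=
  unif_ce_open X U /\
  forall i, (uniform_measure K (U i) <= (2 ^- i)%R%:E)%E.

Definition martin_lof_random (K : realType) (X R : nat -> bool) : Prop :=
  forall U, martin_lof_test K X U -> ~ (\bigcap_i U i) R.

Definition two_random (K : realType) (R : nat -> bool) : Prop :=
  martin_lof_random K (jump emptyset) R.

(* Main.v *)
(** Tree and tests are built around a single functional that reads a program
    number off an initial block 1^e 0 of R, so that one requirement takes care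
    of all reductions.

    Fix a string s and a small mass e.  First extend s so that the mass of the
    R for which the functional gives a wrong answer about A can grow by at most
    e in any further extension.  If for every N some further extension computed
    A correctly below N with mass > e, then A would be computable: any answer
    given with mass > e outside of the R already known to err has to be right.
    So there is N such that no extension computes A correctly below N with mass
    > e; extending once more, the agreement of the functional with A below N
    also stops growing, up to mass e.  Over the resulting string the length of
    agreement with A can only increase on a set of R of mass 2e, whatever the
    extension.  Whether a string (together with N) has this property is a
    question about the halting of a search, so 0' finds such strings, and
    iterating this along all finite 0-1 sequences yields T.

    If S in [T] and S (+) R computes A, then the length of agreement of the
    functional on R keeps growing along the nodes of T below S, so R is caught
    by a test that collects the sets of R on which agreement grows from a node
    of T to one of its successors.  The sum of their masses is small, and 0'
    enumerates them. *)
Require Import Defs.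
From Stdlib Require Import Cantor.
From mathcomp Require Import all_boot all_order all_algebra.
From mathcomp Require Import all_classical all_reals all_analysis.
From mathcomp Require Import zify lra.
Import Order.TTheory GRing.Theory Num.Theory.

Set Implicit Arguments.
Unset Strict Implicit.
Unset Printing Implicit Defensive.
Generalizable Variables T U.

Local Open Scope nat_scope.
Local Notation eval := Defs.eval.

(** * Encodings and computable functions *)

Definition npair1 n := (Cantor.of_nat n).1.
Definition npair2 n := (Cantor.of_nat n).2.

Lemma npair1E a b : npair1 (npair a b) = a.
Proof. by rewrite /npair1 /npair Cantor.cancel_of_to. Qed.

Lemma npair2E a b : npair2 (npair a b) = b.
Proof. by rewrite /npair2 /npair Cantor.cancel_of_to. Qed.

Lemma npairK n : npair (npair1 n) (npair2 n) = n.
Proof. by rewrite /npair /npair1 /npair2 -surjective_pairing Cantor.cancel_to_of. Qed.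

Lemma npair_double a b : npair a b * 2 = b * 2 + (b + a) * (b + a).+1.
Proof. exact: Cantor.to_nat_spec. Qed.

Lemma leq_npairl a b : a <= npair a b.
Proof. by have := npair_double a b; nia. Qed.

Lemma leq_npairr a b : b <= npair a b.
Proof. by have := npair_double a b; nia. Qed.

Lemma ltn_npairr a b : 0 < a -> b < npair a b.
Proof. by have := npair_double a b; nia. Qed.

Lemma str_code_inv : exists g, cancel str_code g /\ cancel g str_code.
Proof. by case: str_code_bij => g gK Kg; exists g. Qed.

Definition str_of : nat -> seq bool := sval (cid str_code_inv).

Lemma str_codeK : cancel str_code str_of.
Proof. by rewrite /str_of; case: cid => g []. Qed.

Lemma str_ofK : cancel str_of str_code.
Proof. by rewrite /str_of; case: cid => g []. Qed.

Lemma str_code_cons b s : str_code (b :: s) = (str_code s).*2 + b.+1.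
Proof. by []. Qed.

Lemma size_le_str_code s : size s <= str_code s.
Proof. by elim: s => //= b s; lia. Qed.

Lemma str_code_rcons s b : str_code (rcons s b) = str_code s + 2 ^ size s * b.+1.
Proof. by elim: s => [|a s IHs] //=; [case: b|rewrite IHs expnS; lia]. Qed.

Class encodable (T : Type) := enc : T -> nat.
#[global] Instance encodable_nat : encodable nat := id.
#[global] Instance encodable_bool : encodable bool := nat_of_bool.
#[global] Instance encodable_str : encodable (seq bool) := str_code.

Lemma enc_str (s : seq bool) : enc s = str_code s.
Proof. by []. Qed.

#[global] Instance encodable_prod (T U : Type) `{encodable T} `{encodable U} :
  encodable (T * U) := fun p => npair (enc p.1) (enc p.2).

(** [decK] makes the encoding surjective, so that a search through all numbers is a search through
    [T]. The type [bool] is encodable but not decodable. *)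
Class decodable (T : Type) `{encodable T} :=
  { dec : nat -> T; decK : cancel dec enc; encK : cancel enc dec }.
Arguments decodable T {_}.
#[global] Instance decodable_nat : decodable nat :=
  {| decK := fun=> erefl; encK := fun=> erefl |}.
#[global] Instance decodable_str : decodable (seq bool) :=
  {| decK := str_ofK; encK := str_codeK |}.
#[global, refine] Instance decodable_prod (T U : Type) `{decodable T} `{decodable U} :
  decodable (T * U) := {| dec := fun n => (dec (npair1 n), dec (npair2 n)) |}.
Proof.
- by move=> n; rewrite /enc /encodable_prod !decK npairK.
- by move=> [t u]; rewrite /enc /encodable_prod npair1E npair2E !encK.
Defined.

(** Only codes of elements of [T] are constrained; on other numbers the program may do anything. *)
Definition cfun (X : nat -> bool) (T U : Type) `{encodable T} `{encodable U}
  (f : T -> U) : Prop := exists c, forall t, eval X c (enc t) (enc (f t)).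

Section cfun.
Variable X : nat -> bool.
Context {T : Type} `{encodable T}.
Context {U : Type} `{encodable U}.
Context {V : Type} `{encodable V}.

Lemma cfun_id : cfun X (fun t : T => t).
Proof.
(* The basic functions include no identity; unpairing followed by pairing is one. *)
by exists (Pair Left Right) => t /=; exists (npair1 (enc t)), (npair2 (enc t)); rewrite npairK.
Qed.

Lemma cfun_comp (f : U -> V) (g : T -> U) :
  cfun X f -> cfun X g -> cfun X (fun t => f (g t)).
Proof. by move=> [c Pc] [d Pd]; exists (Comp c d) => t /=; exists (enc (g t)). Qed.

Lemma cfun_pair (f : T -> U) (g : T -> V) :
  cfun X f -> cfun X g -> cfun X (fun t => (f t, g t)).
Proof.
by move=> [c Pc] [d Pd]; exists (Pair c d) => t /=; exists (enc (f t)), (enc (g t)).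
Qed.

Lemma cfun_fst (f : T -> U * V) : cfun X f -> cfun X (fun t => (f t).1).
Proof.
move=> [c Pc]; exists (Comp Left c) => t /=; exists (enc (f t)) => //.
by rewrite [in RHS]/enc /encodable_prod -/(npair1 _) npair1E.
Qed.

Lemma cfun_snd (f : T -> U * V) : cfun X f -> cfun X (fun t => (f t).2).
Proof.
move=> [c Pc]; exists (Comp Right c) => t /=; exists (enc (f t)) => //.
by rewrite [in RHS]/enc /encodable_prod -/(npair2 _) npair2E.
Qed.

Lemma cfun_oracle (f : T -> nat) : cfun X f -> cfun X (fun t => X (f t)).
Proof. by move=> [c Pc]; exists (Comp Oracle c) => t /=; exists (enc (f t)). Qed.

Lemma cfun_succ (f : T -> nat) : cfun X f -> cfun X (fun t => (f t).+1).
Proof. by move=> [c Pc]; exists (Comp Succ c) => t /=; exists (enc (f t)). Qed.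

(** Primitive recursion with parameter [t]. Conditionals, arithmetic and bounded quantifiers are
    reduced to it below. *)
Lemma cfun_iteri (n : T -> nat) (h : T -> nat -> U -> U) (g : T -> U) :
  cfun X n -> cfun X (fun p : T * (nat * U) => h p.1 p.2.1 p.2.2) -> cfun X g ->
  cfun X (fun t => iteri (n t) (h t) (g t)).
Proof.
move=> [cn Pn] [ch Ph] [cg Pg].
exists (Comp (Prec cg ch) (Pair (Pair Left Right) cn)) => t /=.
exists (npair (enc t) (n t)).
  exists (enc t), (n t); split => //.
  by exists (npair1 (enc t)), (npair2 (enc t)); rewrite npairK.
rewrite -/(npair1 _) -/(npair2 _) npair1E npair2E.
elim: (n t) => [|m IHm] /=; first exact: Pg.
exists (enc (iteri m (h t) (g t))) => //.
exact: (Ph (t, (m, iteri m (h t) (g t)))).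
Qed.

Lemma cfun_const_nat (k : nat) : cfun X (fun=> k : nat).
Proof.
elim: k => [|k [c Pc]]; first by exists Zero.
by exists (Comp Succ c) => t /=; exists k => //; exact: Pc.
Qed.

Lemma cfun_const (u : U) : cfun X (fun=> u).
Proof. by have [c Pc] := cfun_const_nat (enc u); exists c. Qed.

(** On codes, decoding is the identity by [decK], so the program for [f] serves unchanged. *)
Lemma cfun_dec {D : decodable U} (f : T -> nat) :
  cfun X f -> cfun X (fun t => dec (f t) : U).
Proof. by move=> [c Pc]; exists c => t; rewrite decK; exact: Pc. Qed.

Lemma cfun_enc (f : T -> U) : cfun X f -> cfun X (fun t => enc (f t)).
Proof. by move=> [c Pc]; exists c. Qed.

Lemma eq_cfun (f g : T -> U) : f =1 g -> cfun X g -> cfun X f.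
Proof. by move=> fg [c Pc]; exists c => t; rewrite fg. Qed.

End cfun.

(** * Boolean and arithmetic operations *)

Lemma cfun_nat_of_bool X `{encodable T} (b : T -> bool) :
  cfun X b -> cfun X (fun t => b t : nat).
Proof. exact: cfun_enc. Qed.

Lemma cfun_if X `{encodable T} `{encodable U} (b : T -> bool) (f g : T -> U) :
  cfun X b -> cfun X f -> cfun X g ->
  cfun X (fun t => if b t then f t else g t).
Proof.
(* A conditional is an iteration performed zero or one times. *)
move=> cb cf cg; apply: (eq_cfun (g := fun t => iteri (b t) (fun _ _ => f t) (g t))).
  by move=> t; case: (b t).
apply: cfun_iteri => //.
by apply: cfun_comp => //; apply: cfun_fst; exact: cfun_id.
Qed.

Lemma cfun_andb X `{encodable T} (b c : T -> bool) :
  cfun X b -> cfun X c -> cfun X (fun t => b t && c t).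
Proof. by move=> cb cc; apply: cfun_if => //; exact: cfun_const. Qed.

Lemma cfun_orb X `{encodable T} (b c : T -> bool) :
  cfun X b -> cfun X c -> cfun X (fun t => b t || c t).
Proof. by move=> cb cc; apply: cfun_if => //; exact: cfun_const. Qed.

Lemma cfun_implyb X `{encodable T} (b c : T -> bool) :
  cfun X b -> cfun X c -> cfun X (fun t => b t ==> c t).
Proof. by move=> cb cc; apply: cfun_if => //; exact: cfun_const. Qed.

Lemma cfun_negb X `{encodable T} (b : T -> bool) :
  cfun X b -> cfun X (fun t => ~~ b t).
Proof. by move=> cb; apply: cfun_if => //; exact: cfun_const. Qed.

Lemma cfun_pred X `{encodable T} (f : T -> nat) :
  cfun X f -> cfun X (fun t => (f t).-1).
Proof.
move=> cf; apply: (eq_cfun (g := fun t => iteri (f t) (fun m _ => m) 0)).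
  by move=> t; case: (f t).
apply: cfun_iteri => //; last exact: cfun_const.
by apply: cfun_fst; apply: cfun_snd; exact: cfun_id.
Qed.

Lemma cfun_add X `{encodable T} (f g : T -> nat) :
  cfun X f -> cfun X g -> cfun X (fun t => f t + g t).
Proof.
move=> cf cg; apply: (eq_cfun (g := fun t => iteri (f t) (fun _ => S) (g t))).
  by move=> t; elim: (f t) => //= m <-.
by apply: cfun_iteri => //; apply: cfun_succ; do 2!apply: cfun_snd; exact: cfun_id.
Qed.

Lemma cfun_sub X `{encodable T} (f g : T -> nat) :
  cfun X f -> cfun X g -> cfun X (fun t => f t - g t).
Proof.
move=> cf cg; apply: (eq_cfun (g := fun t => iteri (g t) (fun _ => predn) (f t))).
  by move=> t; elim: (g t) => [|m IHm]; rewrite ?subn0// subnS IHm.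
by apply: cfun_iteri => //; apply: cfun_pred; do 2!apply: cfun_snd; exact: cfun_id.
Qed.

Lemma cfun_mul X `{encodable T} (f g : T -> nat) :
  cfun X f -> cfun X g -> cfun X (fun t => f t * g t).
Proof.
move=> cf cg; apply: (eq_cfun (g := fun t => iteri (f t) (fun _ => addn (g t)) 0)).
  by move=> t; elim: (f t) => //= m <-; rewrite mulSn.
apply: cfun_iteri => //; last exact: cfun_const.
apply: cfun_add; last by do 2!apply: cfun_snd; exact: cfun_id.
by apply: cfun_comp => //; apply: cfun_fst; exact: cfun_id.
Qed.

Lemma cfun_expn X `{encodable T} (f g : T -> nat) :
  cfun X f -> cfun X g -> cfun X (fun t => f t ^ g t).
Proof.
move=> cf cg; apply: (eq_cfun (g := fun t => iteri (g t) (fun _ => muln (f t)) 1)).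
  by move=> t; elim: (g t) => //= m <-; rewrite expnS.
apply: cfun_iteri => //; last exact: cfun_const.
apply: cfun_mul; last by do 2!apply: cfun_snd; exact: cfun_id.
by apply: cfun_comp => //; apply: cfun_fst; exact: cfun_id.
Qed.

Lemma cfun_leq X `{encodable T} (f g : T -> nat) :
  cfun X f -> cfun X g -> cfun X (fun t => f t <= g t).
Proof.
move=> cf cg.
apply: (eq_cfun (g := fun t => iteri (f t - g t) (fun _ _ => false) true)).
  by move=> t; rewrite /leq; case: (_ - _).
by apply: cfun_iteri; [exact: cfun_sub|exact: cfun_const|exact: cfun_const].
Qed.

Lemma cfun_eqn X `{encodable T} (f g : T -> nat) :
  cfun X f -> cfun X g -> cfun X (fun t => f t == g t).
Proof.
move=> cf cg; apply: (eq_cfun (g := fun t => (f t <= g t) && (g t <= f t))).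
  by move=> t; rewrite eqn_leq.
by apply: cfun_andb; exact: cfun_leq.
Qed.

Lemma cfun_eqb X `{encodable T} (b c : T -> bool) :
  cfun X b -> cfun X c -> cfun X (fun t => b t == c t).
Proof.
move=> cb cc; apply: (eq_cfun (g := fun t => (b t : nat) == c t)).
  by move=> t; case: (b t); case: (c t).
by apply: cfun_eqn; exact: cfun_nat_of_bool.
Qed.

Lemma cfun_odd X `{encodable T} (f : T -> nat) :
  cfun X f -> cfun X (fun t => odd (f t)).
Proof.
move=> cf; apply: (eq_cfun (g := fun t => iteri (f t) (fun _ => negb) false)).
  by move=> t; elim: (f t) => //= m <-.
apply: cfun_iteri => //; last exact: cfun_const.
by apply: cfun_negb; do 2!apply: cfun_snd; exact: cfun_id.
Qed.

Lemma cfun_half X `{encodable T} (f : T -> nat) :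
  cfun X f -> cfun X (fun t => (f t)./2).
Proof.
move=> cf.
(* Half of a number counts the odd numbers below it. *)
apply: (eq_cfun (g := fun t => iteri (f t) (fun m z => z + odd m) 0)).
  by move=> t; elim: (f t) => //= m <-; rewrite uphalf_half addnC.
apply: cfun_iteri => //; last exact: cfun_const.
apply: cfun_add; first by do 2!apply: cfun_snd; exact: cfun_id.
apply: cfun_nat_of_bool; apply: cfun_odd.
by apply: cfun_fst; apply: cfun_snd; exact: cfun_id.
Qed.

Lemma cfun_npair1 X `{encodable T} (f : T -> nat) :
  cfun X f -> cfun X (fun t => npair1 (f t)).
Proof. by move=> [c Pc]; exists (Comp Left c) => t /=; exists (f t) => //; exact: Pc. Qed.

Lemma cfun_npair2 X `{encodable T} (f : T -> nat) :
  cfun X f -> cfun X (fun t => npair2 (f t)).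
Proof. by move=> [c Pc]; exists (Comp Right c) => t /=; exists (f t) => //; exact: Pc. Qed.

Lemma cfun_npair X `{encodable T} (f g : T -> nat) :
  cfun X f -> cfun X g -> cfun X (fun t => npair (f t) (g t)).
Proof.
by move=> [c Pc] [d Pd]; exists (Defs.Pair c d) => t /=; exists (f t), (g t).
Qed.

(** * Bounded sums and quantifiers *)

Lemma cfun_sum X `{encodable T} (f : T -> nat) (h : T -> nat -> nat) :
 
  cfun X f -> cfun X (fun p : T * nat => h p.1 p.2) ->
  cfun X (fun t => \sum_(0 <= i < f t) h t i).
Proof.
move=> cf ch; apply: (eq_cfun (g := fun t => iteri (f t) (fun m z => z + h t m) 0)).
  move=> t; elim: (f t) => [|m IHm] /=; first by rewrite big_geq.
  by rewrite big_nat_recr//= IHm.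
apply: cfun_iteri => //; last exact: cfun_const.
apply: cfun_add; first by do 2!apply: cfun_snd; exact: cfun_id.
apply: (cfun_comp (f := fun p => h p.1 p.2) (g := fun p => (p.1, p.2.1))) => //.
apply: cfun_pair; apply: cfun_fst; first exact: cfun_id.
by apply: cfun_snd; exact: cfun_id.
Qed.

Lemma cfun_has X `{encodable T} (f : T -> nat) (h : T -> nat -> bool) :
 
  cfun X f -> cfun X (fun p : T * nat => h p.1 p.2) ->
  cfun X (fun t => has (h t) (iota 0 (f t))).
Proof.
move=> cf ch; apply: (eq_cfun (g := fun t => 0 < \sum_(0 <= i < f t) h t i)).
  move=> t; rewrite lt0n sum_nat_seq_eq0 /index_iota subn0 -has_predC.
  by apply: eq_has => i /=; case: (h t i).
apply: cfun_leq; first exact: cfun_const.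
by apply: cfun_sum => //; exact: cfun_nat_of_bool.
Qed.

Lemma cfun_all X `{encodable T} (f : T -> nat) (h : T -> nat -> bool) :
 
  cfun X f -> cfun X (fun p : T * nat => h p.1 p.2) ->
  cfun X (fun t => all (h t) (iota 0 (f t))).
Proof.
move=> cf ch; apply: (eq_cfun (g := fun t => ~~ has (fun i => ~~ h t i) (iota 0 (f t)))).
  by move=> t; rewrite -[RHS]all_predC; apply: eq_all => i /=; rewrite negbK.
by apply: cfun_negb; apply: cfun_has => //; exact: cfun_negb.
Qed.

(** * Operations on binary strings *)

Lemma cfun_nilp X `{encodable T} (s : T -> seq bool) :
  cfun X s -> cfun X (fun t => nilp (s t)).
Proof.
move=> cs; apply: (eq_cfun (g := fun t => str_code (s t) == 0)).
  by move=> t; case: (s t) => //= b r; apply/esym/negbTE; lia.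
apply: cfun_eqn; last exact: cfun_const.
exact: (cfun_enc cs).
Qed.

Lemma cfun_behead X `{encodable T} (s : T -> seq bool) :
  cfun X s -> cfun X (fun t => behead (s t)).
Proof.
move=> [c Pc].
have [d Pd] : cfun X (fun n : nat => n.-1./2 : nat).
  by apply: cfun_half; apply: cfun_pred; exact: cfun_id.
exists (Comp d c) => t /=; exists (enc (s t)) => //.
suff e : str_code (behead (s t)) = (str_code (s t)).-1./2.
  by rewrite !enc_str e; exact: Pd.
case: (s t) => [//|b r].
by rewrite str_code_cons [behead _]/=; move: (str_code r) => k; case: b => /=; lia.
Qed.

Lemma cfun_head X `{encodable T} (s : T -> seq bool) :
  cfun X s -> cfun X (fun t => head false (s t)).
Proof.
(* The code of [b :: r] is [2k + b + 1], so [b] is true exactly when it is even; code 0 is the empty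
   string, with default head [false]. *)
move=> cs; apply: (eq_cfun (g := fun t => (0 < str_code (s t)) && ~~ odd (str_code (s t)))).
  move=> t; case: (s t) => [//|b r].
  by rewrite str_code_cons [head _ _]/=; move: (str_code r) => k; case: b => /=; lia.
apply: cfun_andb; last by apply: cfun_negb; apply: cfun_odd; exact: (cfun_enc cs).
by apply: cfun_leq; [exact: cfun_const|exact: (cfun_enc cs)].
Qed.

Lemma cfun_cons X `{encodable T} (b : T -> bool) (s : T -> seq bool) :
  cfun X b -> cfun X s -> cfun X (fun t => b t :: s t).
Proof.
move=> cb cs.
have [c Pc] : cfun X (fun t => str_code (s t) + str_code (s t) + (b t).+1).
  apply: cfun_add; first by apply: cfun_add; exact: (cfun_enc cs).
  by apply: cfun_succ; exact: cfun_nat_of_bool.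
by exists c => t; move: (Pc t); rewrite addnn.
Qed.

Lemma cfun_drop X `{encodable T} (f : T -> nat) (s : T -> seq bool) :
  cfun X f -> cfun X s -> cfun X (fun t => drop (f t) (s t)).
Proof.
move=> cf cs; apply: (eq_cfun (g := fun t => iteri (f t) (fun _ => behead) (s t))).
  move=> t; elim: (f t) => [|m IHm] /=; first by rewrite drop0.
  by rewrite -IHm -drop1 drop_drop add1n.
apply: cfun_iteri => //; apply: cfun_behead.
by do 2!apply: cfun_snd; exact: cfun_id.
Qed.

Lemma cfun_nth X `{encodable T} (f : T -> nat) (s : T -> seq bool) :
  cfun X f -> cfun X s -> cfun X (fun t => nth false (s t) (f t)).
Proof.
move=> cf cs; apply: (eq_cfun (g := fun t => head false (drop (f t) (s t)))).
  by move=> t; rewrite -nth0 nth_drop addn0.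
by apply: cfun_head; exact: cfun_drop.
Qed.

Lemma cfun_size X `{encodable T} (s : T -> seq bool) :
  cfun X s -> cfun X (fun t => size (s t)).
Proof.
(* The size counts the [i] for which dropping [i] digits leaves a nonempty string; it is at most the
   code, which bounds the sum. *)
move=> cs; apply: (eq_cfun (g := fun t =>
    \sum_(0 <= i < str_code (s t)) ~~ nilp (drop i (s t)))).
  move=> t; under eq_bigr do rewrite /nilp size_drop subn_eq0 -ltnNge.
  have sumE n m : \sum_(0 <= i < n) (i < m : nat) = minn n m.
    elim: n => [|n IHn]; first by rewrite big_geq// min0n.
    by rewrite big_nat_recr//= IHn; lia.
  by rewrite sumE; apply/esym/minn_idPr; exact: size_le_str_code.
apply: cfun_sum; first exact: (cfun_enc cs).
apply: cfun_nat_of_bool; apply: cfun_negb; apply: cfun_nilp; apply: cfun_drop.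
  by apply: cfun_snd; exact: cfun_id.
by apply: cfun_comp => //; apply: cfun_fst; exact: cfun_id.
Qed.

Lemma cfun_rcons X `{encodable T} (s : T -> seq bool) (b : T -> bool) :
  cfun X s -> cfun X b -> cfun X (fun t => rcons (s t) (b t)).
Proof.
move=> cs cb.
have [c Pc] : cfun X (fun t => str_code (s t) + 2 ^ size (s t) * (b t).+1).
  apply: cfun_add; first exact: (cfun_enc cs).
  apply: cfun_mul; last by apply: cfun_succ; exact: cfun_nat_of_bool.
  by apply: cfun_expn; [exact: cfun_const|exact: cfun_size].
by exists c => t; rewrite enc_str str_code_rcons; exact: Pc.
Qed.

Lemma cfun_prefix X `{encodable T} (s u : T -> seq bool) :
  cfun X s -> cfun X u -> cfun X (fun t => prefix (s t) (u t)).
Proof.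
move=> cs cu; apply: (eq_cfun (g := fun t => (size (s t) <= size (u t)) &&
   all (fun i => nth false (s t) i == nth false (u t) i) (iota 0 (size (s t))))).
  move=> t; apply/prefixP/andP => [[r ->]|[szle /allP e]].
    rewrite size_cat leq_addr; split => //; apply/allP => i.
    by rewrite mem_iota => /= lti; rewrite nth_cat lti.
  exists (drop (size (s t)) (u t)); rewrite -[LHS](cat_take_drop (size (s t))).
  congr (_ ++ _); apply: (@eq_from_nth _ false); rewrite size_takel// => i lti.
  by rewrite nth_take//; apply/esym/eqP/e; rewrite mem_iota.
have cs1 : cfun X (fun p : T * nat => s p.1).
  by apply: cfun_comp => //; apply: cfun_fst; exact: cfun_id.
have cu1 : cfun X (fun p : T * nat => u p.1).
  by apply: cfun_comp => //; apply: cfun_fst; exact: cfun_id.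
have c2 : cfun X (fun p : T * nat => p.2) by apply: cfun_snd; exact: cfun_id.
apply: cfun_andb; first by apply: cfun_leq; exact: cfun_size.
by apply: cfun_all; [exact: cfun_size|apply: cfun_eqb; exact: cfun_nth].
Qed.

Ltac cfun_step :=
  cbv beta;
  lazymatch goal with
  | |- cfun _ (fun x => x) => apply: cfun_id
  | |- cfun _ (fun _ => ?c) => apply: (cfun_const _ c)
  | |- cfun _ (fun _ => fst _) => apply: cfun_fst
  | |- cfun _ (fun _ => snd _) => apply: cfun_snd
  | |- cfun _ (fun _ => (_, _)) => apply: cfun_pair
  | |- cfun _ (fun _ => S _) => apply: cfun_succ
  | |- cfun _ (fun _ => npair1 _) => apply: cfun_npair1
  | |- cfun _ (fun _ => npair2 _) => apply: cfun_npair2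
  | |- cfun _ (fun _ => npair _ _) => apply: cfun_npair
  | |- cfun _ (fun _ => addn _ _) => apply: cfun_add
  | |- cfun _ (fun _ => subn _ _) => apply: cfun_sub
  | |- cfun _ (fun _ => muln _ _) => apply: cfun_mul
  | |- cfun _ (fun _ => expn _ _) => apply: cfun_expn
  | |- cfun _ (fun _ => Nat.pred _) => apply: cfun_pred
  | |- cfun _ (fun _ => leq _ _) => apply: cfun_leq
  | |- cfun _ (fun _ => odd _) => apply: cfun_odd
  | |- cfun _ (fun _ => half _) => apply: cfun_half
  | |- cfun _ (fun _ => nat_of_bool _) => apply: cfun_nat_of_bool
  | |- cfun _ (fun _ => andb _ _) => apply: cfun_andb
  | |- cfun _ (fun _ => orb _ _) => apply: cfun_orb
  | |- cfun _ (fun _ => negb _) => apply: cfun_negb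
  | |- cfun _ (fun _ => implb _ _) => apply: cfun_implyb
  | |- cfun _ (fun _ => if _ then _ else _) => apply: cfun_if
  | |- cfun _ (fun _ => eq_op _ _) => first [apply: cfun_eqn | apply: cfun_eqb]
  | |- cfun _ (fun _ => has _ (iota 0 _)) => apply: cfun_has
  | |- cfun _ (fun _ => all _ (iota 0 _)) => apply: cfun_all
  | |- cfun _ (fun _ => nth false _ _) => apply: cfun_nth
  | |- cfun _ (fun _ => size _) => apply: cfun_size
  | |- cfun _ (fun _ => prefix _ _) => apply: cfun_prefix
  | |- cfun _ (fun _ => rcons _ _) => apply: cfun_rcons
  | |- cfun _ (fun _ => cons _ _) => apply: cfun_cons
  | |- cfun _ (fun _ => str_code _) => apply: cfun_enc
  | |- cfun _ (fun _ => str_of _) => refine (cfun_dec (D := decodable_str) _)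
  | |- cfun _ (fun _ => dec _) => refine (cfun_dec _)
  | |- cfun _ fst => refine (cfun_fst (cfun_id _))
  | |- cfun _ size => refine (cfun_size (cfun_id _))
  | |- cfun _ snd => refine (cfun_snd (cfun_id _))
  | H : cfun _ ?f |- cfun _ (fun _ => ?f _) => apply: (cfun_comp H)
  end.
Ltac cfun_tac := repeat first [assumption | cfun_step].

(** * Unbounded search and the jump *)

Lemma cfun_mu_code X (T U : Type) `{encodable T} `{decodable U} (Q : T -> U -> bool) :
  cfun X (fun p : T * U => Q p.1 p.2) ->
  exists c, (forall t u, Q t u -> exists y, eval X c (enc t) y) /\
    (forall t y, eval X c (enc t) y -> Q t (dec y)).
Proof.
move=> cQ.
have [d Pd] : cfun X (fun p : T * nat => ~~ Q p.1 (dec p.2)).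
  apply: cfun_negb; apply: (cfun_comp (f := fun p => Q p.1 p.2)
    (g := fun p : T * nat => (p.1, dec p.2))) => //.
  by cfun_tac.
have {}Pd t k : eval X d (npair (enc t) k) (~~ Q t (dec k)) by exact: (Pd (t, k)).
(* Minimization looks for a zero, hence the negation of [Q] in [d]. *)
exists (Mu d); split => [t u Qtu|t y /= [+ _]]; last first.
  by move=> /(eval_functional (Pd t y)); case: (Q t _).
have [|m Qm mmin] := @ex_minnP (fun k => Q t (dec k)).
  by exists (enc u); rewrite encK.
exists m; split; first by have := Pd t m; rewrite Qm.
move=> k ltkm; exists 0; have := Pd t k; case: (boolP (Q t (dec k))) => // /mmin.
by rewrite leqNgt ltkm.
Qed.

(** Classical choice only names the output of a search that is known to halt, so the selected
    function stays computable. *)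
Lemma cfun_choose X (T U : Type) `{encodable T} `{decodable U} (Q : T -> U -> bool) :
  cfun X (fun p : T * U => Q p.1 p.2) -> (forall t, exists u, Q t u) ->
  exists2 f, cfun X f & forall t, Q t (f t).
Proof.
move=> /cfun_mu_code[c [c_halts c_sound]] exQ.
have halts (t : T) : exists y, eval X c (enc t) y by have [u] := exQ t; exact: c_halts.
exists (fun t => dec (sval (cid (halts t)))) => [|t].
  by exists c => t; rewrite decK; case: cid.
by apply: c_sound; case: cid.
Qed.

(** The jump only asks whether a program halts on its own number; precomposing with a constant
    program turns this into halting on a prescribed input. *)
Fixpoint const_code (k : nat) : Defs.code :=
  if k is m.+1 then Comp Succ (const_code m) else Zero.

Lemma eval_const_code X k n : eval X (const_code k) n k.
Proof. by elim: k => //= k IHk; exists k. Qed.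

Lemma cfun_exists_jump (T U : Type) `{encodable T} `{decodable U} (Q : T -> U -> bool) :
  (forall X, cfun X (fun p : T * U => Q p.1 p.2)) ->
  cfun (jump emptyset) (fun t => `[< exists u, Q t u >]).
Proof.
move=> /(_ emptyset) /cfun_mu_code[c [c_halts c_sound]].
apply: (eq_cfun (g := fun t => jump emptyset (encode (Comp c (const_code (enc t)))))).
  move=> t; apply: asbool_equiv_eq; split => [[u /c_halts[y cy]]|].
    exists (Comp c (const_code (enc t))); split => //; exists y => /=.
    by exists (enc t) => //; exact: eval_const_code.
  move=> [d [/encode_inj <- [y /= [z cz cy]]]]; exists (dec y); apply: c_sound.
  by rewrite -(eval_functional cz (eval_const_code _ _ _)).
apply: cfun_oracle.
(* The number of the composed program is computed from [t] by iteration; 6 is the tag of [Comp]. *)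
apply: (eq_cfun (g := fun t => npair 6 (npair (encode c)
   (iteri (enc t) (fun _ => fun z => npair 6 (npair (encode Succ) z)) (encode Zero))))).
  by move=> t /=; congr (npair 6 (npair _ _)); elim: (enc t) => //= k ->.
do 2!(apply: cfun_npair; first exact: cfun_const).
apply: cfun_iteri; last exact: cfun_const.
  by apply: cfun_enc; exact: cfun_id.
by cfun_tac.
Qed.

(** * A universal functional with finite oracles *)

(** Positions beyond the end of [w] read [false], so [w] always denotes a finite set of triples. *)
Definition fact (w : seq bool) c n y := nth false w (npair c (npair n y)).

(** A string w is read as a finite set of facts "program c maps n to y", and
    [justified] says that a fact follows from those in w by one evaluation rule
    ([ob] tells whether a fact about the oracle is accepted).  No order on the
    facts is needed to rule out circular justifications: a fact only appeals to
    smaller programs, or to the same program at a smaller recursion argument. *)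
Definition justified (ob : bool) (w : seq bool) (c n y : nat) : bool :=
  if npair1 c == 0 then y == 0 else
  if npair1 c == 1 then y == n.+1 else
  if npair1 c == 2 then y == npair1 n else
  if npair1 c == 3 then y == npair2 n else
  if npair1 c == 4 then ob else
  if npair1 c == 5 then
    fact w (npair1 (npair2 c)) n (npair1 y) && fact w (npair2 (npair2 c)) n (npair2 y) else
  if npair1 c == 6 then
    has (fun z => fact w (npair2 (npair2 c)) n z && fact w (npair1 (npair2 c)) z y)
      (iota 0 (size w)) else
  if npair1 c == 7 then
    if npair2 n == 0 then fact w (npair1 (npair2 c)) (npair1 n) y else
    has (fun z => fact w c (npair (npair1 n) (npair2 n).-1) z &&
                  fact w (npair2 (npair2 c)) (npair (npair1 n) (npair (npair2 n).-1 z)) y)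
      (iota 0 (size w)) else
  if npair1 c == 8 then
    fact w (npair2 c) (npair n y) 0 &&
    all (fun k => has (fun v => fact w (npair2 c) (npair n k) v.+1) (iota 0 (size w)))
      (iota 0 y)
  else false.

Definition valid (ora : nat -> nat -> bool) (w : seq bool) : bool :=
  all (fun i => nth false w i ==>
    justified (ora (npair1 (npair2 i)) (npair2 (npair2 i))) w
      (npair1 i) (npair1 (npair2 i)) (npair2 (npair2 i)))
    (iota 0 (size w)).

Lemma cfun_justified X `{encodable T} (ob : T -> bool) (w : T -> seq bool) (c n y : T -> nat) :
  cfun X ob -> cfun X w -> cfun X c -> cfun X n -> cfun X y ->
  cfun X (fun t => justified (ob t) (w t) (c t) (n t) (y t)).
Proof. by move=> *; rewrite /justified /fact; cfun_tac. Qed.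

(** The oracle s (+) R', where R is 1^e 0 R' and both halves are only consulted
    at positions below [size s]. *)
Definition ora (s : seq bool) (R : nat -> bool) (e n y : nat) : bool :=
  let m := if odd n then n./2 + e.+1 else n./2 in
  (m < size s) && (y == if odd n then R m else nth false s m).

Definition prog (R : nat -> bool) (e : nat) : bool := ~~ R e && all R (iota 0 e).

(** The universal functional: if R starts with 1^e 0, then program e with oracle
    [ora s R e] maps x to y, as witnessed by a set of facts with number below
    [size s].  It only depends on the first [size s] digits of R. *)
Definition output (s : seq bool) (R : nat -> bool) (x y : nat) : bool :=
  has (fun e => prog R e &&
    has (fun j => valid (ora s R e) (str_of j) && fact (str_of j) e x y) (iota 0 (size s)))
    (iota 0 (size s)).

Lemma cfun_output X `{encodable T} (s r : T -> seq bool) (x y : T -> nat) :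
  cfun X s -> cfun X r -> cfun X x -> cfun X y ->
  cfun X (fun t => output (s t) (nth false (r t)) (x t) (y t)).
Proof.
move=> cs cr cx cy; rewrite /output /valid /fact /prog.
cfun_tac; apply: cfun_justified; rewrite /ora; cfun_tac.
Qed.

(** * Monotonicity and consistency of fact sets *)

Lemma has_iotaP (P : pred nat) n : reflect (exists2 i, i < n & P i) (has P (iota 0 n)).
Proof.
by apply: (iffP hasP) => [[i]|[i lti Pi]]; [rewrite mem_iota|]; exists i; rewrite ?mem_iota.
Qed.

Lemma all_iotaP (P : pred nat) n : reflect (forall i, i < n -> P i) (all P (iota 0 n)).
Proof.
by apply: (iffP allP) => h i; rewrite ?mem_iota => *; apply: h => //; rewrite mem_iota.
Qed.

Lemma nth_lt_size w i : nth false w i -> i < size w.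
Proof.
by move=> wi; rewrite ltnNge; apply/negP => /(nth_default false) e; rewrite e in wi.
Qed.

(** Facts occur only positively in [justified], and the bounds on existential witnesses grow with
    [size w]. *)
Lemma justified_mono (ob ob' : bool) w w' c n y :
  (ob -> ob') -> size w <= size w' -> (forall i, nth false w i -> nth false w' i) ->
  justified ob w c n y -> justified ob' w' c n y.
Proof.
move=> oo' szw ww'; rewrite /justified.
have ff' a b d : fact w a b d -> fact w' a b d by exact: ww'.
have hh (P P' : pred nat) : (forall i, P i -> P' i) ->
    has P (iota 0 (size w)) -> has P' (iota 0 (size w')).
  move=> PP' /has_iotaP[i lti Pi]; apply/has_iotaP; exists i; last exact: PP'.
  exact: leq_trans szw.
do 5![case: ifP => // _]; case: ifP => [_ /andP[/ff' -> /ff' ->]//|_].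
case: ifP => [_|_]; first by apply: hh => i /andP[/ff' -> /ff' ->].
case: ifP => [_|_].
  case: ifP => [_|_]; first exact: ff'.
  by apply: hh => i /andP[/ff' -> /ff' ->].
case: ifP => // _ /andP[/ff' -> /= /all_iotaP h].
apply/all_iotaP => i /h; apply: hh => j; exact: ff'.
Qed.

(** The number of a fact bounds its argument, so only oracle queries below [size w] matter: this is
    the use principle. *)
Lemma valid_mono (o o' : nat -> nat -> bool) w :
  (forall n y, n < size w -> o n y -> o' n y) -> valid o w -> valid o' w.
Proof.
move=> oo' /all_iotaP vw; apply/all_iotaP => i lti.
apply/implyP => wi; have := vw i lti; rewrite wi /=; apply: justified_mono => //.
apply: oo'; apply: leq_ltn_trans lti; rewrite -{2}(npairK i) -{2}(npairK (npair2 i)).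
exact: leq_trans (leq_npairl _ _) (leq_npairr _ _).
Qed.

Lemma fact_justified o w c n y : valid o w -> fact w c n y -> justified (o n y) w c n y.
Proof.
move=> /all_iotaP vw f; have := vw _ (nth_lt_size f).
by move: (f); rewrite /fact => -> /=; rewrite !(npair1E, npair2E).
Qed.

(** Valid sets over a single-valued oracle cannot contradict each other: two derivations of a value
    are compared by induction on the program number. *)
Lemma fact_functional (o : nat -> nat -> bool) w w' c n y y' :
  (forall n y y', o n y -> o n y' -> y = y') -> valid o w -> valid o w' ->
  fact w c n y -> fact w' c n y' -> y = y'.
Proof.
move=> ofun vw vw'; elim/ltn_ind: c n y y' => c IHc n y y'.
(* Tag 0 is treated apart, since [npair2 c < c] rests on a positive tag. *)
have [c0|c0] := posnP (npair1 c).
  move=> /(fact_justified vw) + /(fact_justified vw').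
  by rewrite /justified c0 /= => /eqP-> /eqP->.
have ltc : npair2 c < c by rewrite -[ltnRHS]npairK; exact: ltn_npairr.
have lt1 : npair1 (npair2 c) < c.
  by apply: leq_ltn_trans ltc; rewrite -[leqRHS]npairK; exact: leq_npairl.
have lt2 : npair2 (npair2 c) < c.
  by apply: leq_ltn_trans ltc; rewrite -[leqRHS]npairK; exact: leq_npairr.
(* Primitive recursion appeals to [c] itself at a smaller recursion argument, hence an inner
   induction. *)
have [c7|c7] := eqVneq (npair1 c) 7.
  rewrite -(npairK n); move: (npair1 n) => a; elim: (npair2 n) y y' => [|m IHm] y y'
    /(fact_justified vw) + /(fact_justified vw');
    rewrite /justified c7 /= !(npair1E, npair2E) /=.
    exact: IHc.
  move=> /has_iotaP[z _ /andP[z1 z2]] /has_iotaP[z' _ /andP[z1' z2']].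
  by move: z2'; rewrite -(IHm _ _ z1 z1') => z2'; exact: (IHc _ lt2 _ _ _ z2 z2').
move=> /(fact_justified vw) + /(fact_justified vw').
rewrite /justified (negbTE c7); case: ifP => [_ /eqP-> /eqP-> //|_].
do 3![case: ifP => [_ /eqP-> /eqP-> //|_]]; case: ifP => [_|_]; first exact: ofun.
case: ifP => [_|_].
  move=> /andP[f g] /andP[f' g'].
  by rewrite -(npairK y) (IHc _ lt1 _ _ _ f f') (IHc _ lt2 _ _ _ g g') npairK.
case: ifP => [_|_].
  move=> /has_iotaP[z _ /andP[g f]] /has_iotaP[z' _ /andP[g' f']].
  by move: f'; rewrite -(IHc _ lt2 _ _ _ g g'); exact: IHc lt1 _ _ _ f.
case: ifP => // _ /andP[f0 /all_iotaP fk] /andP[f0' /all_iotaP fk'].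
case: (ltngtP y y') => // yy'.
  by have /has_iotaP[v _ fv] := fk' _ yy'; have := IHc _ ltc _ _ _ f0 fv.
by have /has_iotaP[v _ fv] := fk _ yy'; have := IHc _ ltc _ _ _ fv f0'.
Qed.

(** * From computations to fact sets *)

Definition add_facts (w v : seq bool) : seq bool :=
  mkseq (fun i => nth false w i || nth false v i) (maxn (size w) (size v)).

Lemma nth_add_facts w v i : nth false (add_facts w v) i = nth false w i || nth false v i.
Proof.
have [lti|lei] := ltnP i (maxn (size w) (size v)); first by rewrite nth_mkseq.
by rewrite !nth_default ?size_mkseq//; lia.
Qed.

Lemma valid_add_facts o w v : valid o w ->
  (forall c n y, fact v c n y -> justified (o n y) (add_facts w v) c n y) ->
  valid o (add_facts w v).
Proof.
move=> /all_iotaP vw jv; apply/all_iotaP => i lti.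
apply/implyP; rewrite nth_add_facts => /orP[wi|vi].
  have := vw _ (nth_lt_size wi); rewrite wi /=; apply: justified_mono => //.
    by rewrite size_mkseq leq_maxl.
  by move=> j; rewrite nth_add_facts => ->.
by apply: jv; rewrite /fact !npairK.
Qed.

Definition one_fact c n y := rcons (nseq (npair c (npair n y)) false) true.

Lemma one_factP c n y c' n' y' :
  fact (one_fact c n y) c' n' y' = [&& c' == c, n' == n & y' == y].
Proof.
rewrite /fact nth_rcons size_nseq nth_nseq; set i := npair c' _; set j := npair c _.
rewrite if_same; case: ltngtP => ij; first 2 last.
- by have [-> /npair_inj[-> ->]] := npair_inj ij; rewrite !eqxx.
- by apply/esym/negP => /and3P[/eqP e1 /eqP e2 /eqP e3]; move: ij; rewrite /i /j e1 e2 e3 ltnn.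
- by apply/esym/negP => /and3P[/eqP e1 /eqP e2 /eqP e3]; move: ij; rewrite /i /j e1 e2 e3 ltnn.
Qed.

Lemma valid_union o w v : valid o w -> valid o v -> valid o (add_facts w v).
Proof.
move=> vw vv; apply: valid_add_facts => // c n y /(fact_justified vv).
apply: justified_mono => //; first by rewrite size_mkseq leq_maxr.
by move=> j; rewrite nth_add_facts => ->; rewrite orbT.
Qed.

Lemma valid_add_one o w c n y : valid o w -> justified (o n y) w c n y ->
  valid o (add_facts w (one_fact c n y)) /\ fact (add_facts w (one_fact c n y)) c n y.
Proof.
move=> vw jw; split; last first.
  by rewrite /fact nth_add_facts -/(fact _ c n y) -/(fact _ c n y) one_factP !eqxx orbT.
apply: valid_add_facts => // c' n' y'; rewrite one_factP => /and3P[/eqP-> /eqP-> /eqP->].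
apply: justified_mono jw => //; first by rewrite size_mkseq leq_maxl.
by move=> j; rewrite nth_add_facts => ->.
Qed.

(** This is why the searches in [justified] can be bounded by [size w]. *)
Lemma fact_bound w c n y : fact w c n y -> y < size w.
Proof.
move=> /nth_lt_size; apply: leq_ltn_trans.
exact: leq_trans (leq_npairr _ _) (leq_npairr _ _).
Qed.

Lemma fact_addl w v c n y : fact w c n y -> fact (add_facts w v) c n y.
Proof. by rewrite /fact nth_add_facts => ->. Qed.

Lemma fact_addr w v c n y : fact v c n y -> fact (add_facts w v) c n y.
Proof. by rewrite /fact nth_add_facts => ->; rewrite orbT. Qed.

Definition graph (Y : nat -> bool) (n y : nat) : bool := y == Y n.

(** Each evaluation rule unites the fact sets of its premises and adds one fact for its
    conclusion. *)
Lemma eval_fact Y c n y : eval Y c n y ->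
  exists w, valid (graph Y) w /\ fact w (encode c) n y.
Proof.
set o := graph Y.
have v0 : valid o [::] by [].
have add1 w c' n' y' : valid o w -> justified (o n' y') w c' n' y' ->
    exists w', valid o w' /\ fact w' c' n' y'.
  by move=> vw /(valid_add_one vw)[]; eexists; split; eassumption.
elim: c n y => [|||||f IHf g IHg|f IHf g IHg|f IHf g IHg|f IHf] n y /=.
- by move=> ->; apply: add1 v0 _; rewrite /justified npair1E.
- by move=> ->; apply: add1 v0 _; rewrite /justified npair1E /=.
- by move=> ->; apply: add1 v0 _; rewrite /justified npair1E /=.
- by move=> ->; apply: add1 v0 _; rewrite /justified npair1E /=.
- by move=> ->; apply: add1 v0 _; rewrite /justified npair1E /o /graph /=.
- move=> [a [b [/IHf[w [vw fw]] /IHg[v [vv gv]] ->]]].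
  apply: (add1 (add_facts w v)); first exact: valid_union.
  by rewrite /justified npair1E npair2E !(npair1E, npair2E) /= fact_addl// fact_addr.
- move=> [z /IHg[w [vw gw]] /IHf[v [vv fv]]].
  apply: (add1 (add_facts w v)); first exact: valid_union.
  rewrite /justified npair1E npair2E !(npair1E, npair2E) /=; apply/has_iotaP; exists z.
    exact: fact_bound (fact_addl _ gw).
  by rewrite fact_addl// fact_addr.
- rewrite -/(npair1 n) -/(npair2 n) -{3}(npairK n).
  elim: (npair2 n) y => [|m IHm] y /=.
    move=> /IHf[w [vw fw]]; apply: (add1 w) => //.
    by rewrite /justified !(npair1E, npair2E).
  move=> [z /IHm[w [vw fw]] /IHg[v [vv gv]]].
  apply: (add1 (add_facts w v)); first exact: valid_union.
  rewrite /justified npair1E npair2E !(npair1E, npair2E) /=; apply/has_iotaP; exists z.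
    exact: fact_bound (fact_addl _ fw).
  by rewrite fact_addl// fact_addr.
- move=> [/IHf[w [vw fw]] fk].
  (* The computations at all [k < y] are collected into one fact set. *)
  have [v [vv fv]] : exists v, valid o v /\
      forall k, k < y -> exists u, fact v (encode f) (npair n k) u.+1.
    elim: {fw} y fk => [|y IHy] fk; first by exists [::].
    have [v [vv fv]] := IHy (fun k lt => fk k (ltnW lt)).
    have [u /IHf[v' [vv' fv']]] := fk y (ltnSn y).
    exists (add_facts v v'); split=> [|k]; first exact: valid_union.
    rewrite ltnS leq_eqVlt => /predU1P[->|/fv[u' fu']].
      by exists u; exact: fact_addr.
    by exists u'; exact: fact_addl.
  apply: (add1 (add_facts w v)); first exact: valid_union.
  rewrite /justified !(npair1E, npair2E) /= fact_addl//=; apply/all_iotaP => k /fv[u fu].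
  apply/has_iotaP; exists u; last exact: fact_addr.
  exact: ltnW (fact_bound (fact_addr w fu)).
Qed.

Lemma nth_prefix s s' i : prefix s s' -> i < size s -> nth false s' i = nth false s i.
Proof. by move=> /prefixP[r ->] lti; rewrite nth_cat lti. Qed.

(** A longer [s] allows more searching and answers more queries, but changes no earlier answer.
    Hence agreement and error sets only grow. *)
Lemma output_mono s s' R x y : prefix s s' -> output s R x y -> output s' R x y.
Proof.
move=> ss' /has_iotaP[e lte /andP[pe /has_iotaP[j ltj /andP[vj fj]]]].
have szs := size_prefix ss'.
apply/has_iotaP; exists e; first exact: leq_trans szs.
rewrite pe; apply/has_iotaP; exists j; first exact: leq_trans szs.
rewrite fj andbT; apply: valid_mono vj => n z _; rewrite /ora.
case: (odd n) => /andP[ltm oz]; rewrite (leq_trans ltm szs)//=.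
by rewrite (nth_prefix ss').
Qed.

Lemma eq_output s R R' x y : (forall i, i < size s -> R i = R' i) ->
  output s R x y = output s R' x y.
Proof.
move=> RR'; apply: eq_in_has => e; rewrite mem_iota => /= lte.
rewrite /prog RR'//; congr (_ && _ && _).
  apply: eq_in_all => i; rewrite mem_iota => /= lti; apply: RR'; exact: ltn_trans lte.
apply: eq_has => j; congr (_ && _).
have oo' : ora s R e =2 ora s R' e.
  move=> n z; rewrite /ora; case: ifP => // _.
  by have [/RR' ->|//] := boolP (_ < _).
by apply/idP/idP; apply: valid_mono => n z _; rewrite oo'.
Qed.

Lemma prog_inj R e e' : prog R e -> prog R e' -> e = e'.
Proof.
move=> /andP[Re /all_iotaP he] /andP[Re' /all_iotaP he'].
case: (ltngtP e e') => // lt; first by rewrite he' in Re.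
by rewrite he in Re'.
Qed.

Lemma output_functional s R x y y' : output s R x y -> output s R x y' -> y = y'.
Proof.
move=> /has_iotaP[e _ /andP[pe /has_iotaP[j _ /andP[vj fj]]]].
move=> /has_iotaP[e' _ /andP[pe' /has_iotaP[j' _ /andP[vj' fj']]]].
move: vj' fj'; rewrite -(prog_inj pe pe') => vj' fj'.
apply: (fact_functional _ vj vj' fj fj') => n z z' /andP[_ /eqP->] /andP[_ /eqP->] //.
Qed.

(** The sequence 1^e 0 followed by [R]. *)
Definition with_prog (e : nat) (R : nat -> bool) : nat -> bool :=
  fun i => (i < e) || (e < i) && R (i - e.+1).

Lemma prog_with_prog e R : prog (with_prog e R) e.
Proof.
rewrite /prog /with_prog ltnn /=; apply/all_iotaP => i lti.
by rewrite lti.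
Qed.

Lemma eval_output S R c x y : eval (Defs.join S R) c x y ->
  exists L, forall s, L <= size s -> s = mkseq S (size s) ->
    output s (with_prog (encode c) R) x y.
Proof.
(* Such a length exceeds the number of the fact set, the program number, and all queried positions,
   including those of [R] shifted by [encode c + 1]. *)
move=> /eval_fact[w [vw fw]]; exists (size w + str_code w + encode c).+1 => s Ls sS.
apply/has_iotaP; exists (encode c); first by lia.
rewrite prog_with_prog; apply/has_iotaP; exists (str_code w); first by lia.
rewrite str_codeK fw andbT; apply: valid_mono vw => n z ltn /eqP ->.
rewrite /ora /Defs.join; case: ifP => on; apply/andP; split; try by lia.
  rewrite /with_prog addnK; have -> : (n./2 + (encode c).+1 < encode c) = false by lia.
  by have -> : encode c < n./2 + (encode c).+1 by lia.
by rewrite sS nth_mkseq//; lia.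
Qed.

(** * Counting strings *)

Fixpoint strs (n : nat) : seq (seq bool) :=
  if n is m.+1 then map (cons false) (strs m) ++ map (cons true) (strs m) else [:: [::]].

Definition cnt (n : nat) (Q : pred (seq bool)) : nat := count Q (strs n).

Lemma size_strs n : size (strs n) = 2 ^ n.
Proof. by elim: n => //= n IHn; rewrite size_cat !size_map IHn expnS mul2n addnn. Qed.

Lemma mem_strs n s : (s \in strs n) = (size s == n).
Proof.
elim: n s => [|n IHn] s; first by rewrite inE size_eq0.
rewrite /= mem_cat; apply/orP/idP => [|].
  by case=> /mapP[r]; rewrite IHn => /eqP <- ->.
case: s => // b s; rewrite /= eqSS -IHn => sn.
by case: b; [right|left]; apply/mapP; exists s.
Qed.

Lemma cntS n Q : cnt n.+1 Q = cnt n (Q \o cons false) + cnt n (Q \o cons true).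
Proof. by rewrite /cnt /= count_cat !count_map. Qed.

Lemma leq_cnt n (Q Q' : pred (seq bool)) :
  (forall s, size s = n -> Q s -> Q' s) -> cnt n Q <= cnt n Q'.
Proof.
move=> QQ'; rewrite /cnt (eq_in_count (a2 := fun s => (size s == n) && Q s)) => [|s].
  by apply: sub_count => s /andP[/eqP sn]; exact: QQ'.
by rewrite mem_strs => ->.
Qed.

Lemma cnt_prefix m k (Q : pred (seq bool)) :
  (forall s r, size s = m -> Q (s ++ r) = Q s) -> cnt (m + k) Q = cnt m Q * 2 ^ k.
Proof.
elim: m Q => [|m IHm] Q Qs; last first.
  by rewrite addSn !cntS !IHm ?mulnDl// => s r sm /=; rewrite -cat_cons Qs//= sm.
rewrite /cnt /= addn0 add0n -size_strs.
rewrite (eq_count (a2 := fun=> Q [::])) => [|r]; last exact: (Qs [::] r).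
by case: (Q [::]); rewrite ?mul1n ?mul0n ?(count_predT, count_pred0).
Qed.

(** The strings of length [n] have codes below [2 ^ n.+1 - 1], so counting them becomes a bounded
    sum, hence computable. *)
Lemma cntE n (Q : pred (seq bool)) :
  cnt n Q = \sum_(0 <= j < 2 ^ n.+1 - 1) (size (str_of j) == n) && Q (str_of j).
Proof.
have str_of0 : str_of 0 = [::] by apply: (can_inj str_codeK); rewrite str_ofK.
have str_ofS (b : bool) j : str_of (j.*2 + b.+1) = b :: str_of j.
  by apply: (can_inj str_codeK); rewrite str_code_cons !str_ofK.
(* Code 0 is the empty string; odd codes start with [false], positive even ones with [true]. *)
have sum_split m (g : nat -> nat) : \sum_(0 <= j < m.*2.+1) g j =
    g 0 + (\sum_(0 <= j < m) g (j.*2 + 1) + \sum_(0 <= j < m) g (j.*2 + 2)).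
  elim: m => [|m IHm]; first by rewrite big_nat1 !(big_geq (leqnn 0)) !addn0.
  have recr k (h : nat -> nat) : \sum_(0 <= j < k.+1) h j = \sum_(0 <= j < k) h j + h k.
    by rewrite big_nat_recr.
  by rewrite doubleS !recr -recr IHm addn1 addn2; lia.
elim: n Q => [|n IHn] Q; first by rewrite big_nat1 str_of0 /cnt /= addn0.
have -> : 2 ^ n.+2 - 1 = (2 ^ n.+1 - 1).*2.+1.
  by have := expn_gt0 2 n.+1; rewrite (expnS _ n.+1); lia.
rewrite sum_split str_of0 /= add0n cntS !IHn.
by congr (_ + _); apply: eq_bigr => j _; rewrite (str_ofS false, str_ofS true).
Qed.

Lemma cfun_cnt X `{encodable T} (n : T -> nat) (Q : T -> seq bool -> bool) :
  cfun X n -> cfun X (fun p : T * seq bool => Q p.1 p.2) ->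
  cfun X (fun t => cnt (n t) (Q t)).
Proof.
move=> cn cQ; apply: eq_cfun => [t|]; first exact: cntE.
apply: cfun_sum; first by cfun_tac.
have cQ' : cfun X (fun p : T * nat => Q p.1 (str_of p.2)).
  by apply: (cfun_comp (g := fun p : T * nat => (p.1, str_of p.2)) cQ); cfun_tac.
by cfun_tac.
Qed.

(** * Rational masses of sets determined by finitely many digits *)

Local Open Scope ring_scope.

(** Only the length of [s] enters. This is the uniform measure of [Q] whenever [Q] depends on the
    first [size s] digits alone. *)
Definition mass (s : seq bool) (Q : pred (nat -> bool)) : rat :=
  (cnt (size s) (fun r => Q (nth false r)))%:R / 2 ^+ size s.

Lemma mass_le s (Q Q' : pred (nat -> bool)) :
  (forall R, Q R -> Q' R) -> mass s Q <= mass s Q'.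
Proof.
move=> QQ'; rewrite ler_wpM2r ?invr_ge0 ?exprn_ge0// ler_nat.
by apply: leq_cnt => r _; exact: QQ'.
Qed.

Lemma mass_le1 s Q : mass s Q <= 1.
Proof.
rewrite ler_pdivrMr ?exprn_gt0// mul1r -natrX ler_nat -size_strs; exact: count_size.
Qed.

Lemma massU s (Q Q' : pred (nat -> bool)) :
  mass s (fun R => Q R || Q' R) <= mass s Q + mass s Q'.
Proof.
rewrite -mulrDl ler_wpM2r ?invr_ge0 ?exprn_ge0// -natrD ler_nat.
set P := fun r => Q (nth false r); set P' := fun r => Q' (nth false r).
by rewrite -(count_predUI P P') leq_addr.
Qed.

Lemma massD s (Q Q' : pred (nat -> bool)) : (forall R, Q' R -> Q R) ->
  mass s (fun R => Q R && ~~ Q' R) = mass s Q - mass s Q'.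
Proof.
move=> QQ'; rewrite -mulrBl; congr (_ / _); apply/eqP; rewrite eq_sym subr_eq -natrD.
set P := fun r => Q (nth false r); set P' := fun r => Q' (nth false r).
apply/eqP; congr (_%:R); rewrite /cnt -(count_predUI (fun r => P r && ~~ P' r) P').
rewrite [X in (_ + X)%N](eq_count (a2 := pred0)) ?count_pred0 ?addn0 => [|r /=]; last first.
  by rewrite -andbA andNb andbF.
apply: eq_count => r /=; have := QQ' (nth false r); rewrite -/(P r) -/(P' r).
by case: (P r); case: (P' r) => //= ->.
Qed.

Lemma mass_prefix s s' (Q : pred (nat -> bool)) : prefix s s' ->
  (forall R R', (forall i, (i < size s)%N -> R i = R' i) -> Q R = Q R') ->
  mass s' Q = mass s Q.
Proof.
move=> /prefixP[r ->] Qs; rewrite /mass size_cat cnt_prefix; last first.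
  move=> u v us; apply: Qs => i; rewrite -us => lti.
  by rewrite nth_cat lti.
by rewrite natrM natrX exprD -mulf_div divff ?mulr1// expf_neq0.
Qed.

Lemma mass_has s n (Q : nat -> pred (nat -> bool)) :
  mass s (fun R => has (Q^~ R) (iota 0 n)) <= \sum_(0 <= i < n) mass s (Q i).
Proof.
elim: n => [|n IHn].
  rewrite big_geq// /mass /cnt (eq_count (a2 := pred0)) ?count_pred0 ?mul0r//.
rewrite big_nat_recr//; apply: le_trans (lerD IHn (lexx _)).
apply: le_trans (massU _ _ _); apply: mass_le => R.
by rewrite -addn1 iotaD has_cat /= orbF.
Qed.

(** Otherwise every extension of [s] could be extended with a gain above [e], and finitely many such
    steps would exceed [M]. *)
Lemma near_max (f : seq bool -> rat) (M e : rat) s : 0 < e -> (forall r, f r <= M) ->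
  exists2 r, prefix s r & forall u, prefix r u -> f u <= f r + e.
Proof.
move=> e0 fM; apply: contrapT => nmax.
have step r : prefix s r -> exists2 u, prefix r u & f r + e < f u.
  move=> sr; apply: contrapT => nu; apply: nmax; exists r => // u ru.
  by rewrite leNgt; apply/negP => ltu; apply: nu; exists u.
have [k ltk] : exists k : nat, (M - f s) / e < k%:R.
  by exists (Num.truncn ((M - f s) / e)).+1; exact: truncnS_gt.
have [r _] : exists2 r, prefix s r & f s + k%:R * e <= f r.
  elim: {ltk} k => [|k [r sr fr]]; first by exists s; rewrite ?prefix_refl// mul0r addr0.
  have [u ru fu] := step _ sr; exists u; first exact: prefix_trans ru.
  rewrite -[k.+1]addn1 natrD mulrDl mul1r addrA.
  by apply/ltW/(le_lt_trans _ fu); rewrite lerD2r.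
rewrite ltr_pdivrMr// ltrBlDl in ltk => fr.
by have := lt_le_trans ltk (le_trans fr (fM r)); rewrite ltxx.
Qed.

Local Close Scope ring_scope.

(** * Extensions over which agreement with A settles *)

Definition agree (a : nat -> bool) (s : seq bool) (R : nat -> bool) (n : nat) : bool :=
  all (fun x => output s R x (a x)) (iota 0 n).

(** A longer agreement of R with [a] over s' than over s, where agreement with all
    of [a] also counts if s has it already: it may hide a gain beyond [size a]. *)
Definition gain (a s s' : seq bool) (R : nat -> bool) : bool :=
  has (fun n => agree (nth false a) s' R n &&
                ((n == size a) || ~~ agree (nth false a) s R n))
    (iota 0 (size a).+1).

Lemma cfun_agree X `{encodable T} (a s r : T -> seq bool) (n : T -> nat) :
  cfun X a -> cfun X s -> cfun X r -> cfun X n ->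
  cfun X (fun t => agree (nth false (a t)) (s t) (nth false (r t)) (n t)).
Proof. by move=> *; rewrite /agree; cfun_tac; apply: cfun_output; cfun_tac. Qed.

Lemma cfun_gain X `{encodable T} (a s s' r : T -> seq bool) :
  cfun X a -> cfun X s -> cfun X s' -> cfun X r ->
  cfun X (fun t => gain (a t) (s t) (s' t) (nth false (r t))).
Proof. by move=> *; rewrite /gain; cfun_tac; apply: cfun_agree; cfun_tac. Qed.

Lemma agree_mono a s s' R n : prefix s s' -> agree a s R n -> agree a s' R n.
Proof.
by move=> ss' /all_iotaP ag; apply/all_iotaP => x /ag; exact: output_mono.
Qed.

Lemma agree_le a s R m n : m <= n -> agree a s R n -> agree a s R m.
Proof.
move=> mn /all_iotaP ag; apply/all_iotaP => x ltx; apply: ag; exact: leq_trans mn.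
Qed.

Lemma eq_agree a s R R' n : (forall i, i < size s -> R i = R' i) ->
  agree a s R n = agree a s R' n.
Proof. by move=> RR'; apply: eq_all => x; exact: eq_output. Qed.

Lemma eq_in_agree a a' s R n : (forall i, i < n -> a i = a' i) ->
  agree a s R n = agree a' s R n.
Proof. by move=> aa'; apply: eq_in_all => x; rewrite mem_iota => /= /aa' ->. Qed.

Lemma output_lt_size s R x y : output s R x y -> x < size s.
Proof.
move=> /has_iotaP[e _ /andP[_ /has_iotaP[j ltj /andP[_ /nth_lt_size lt]]]].
have := size_le_str_code (str_of j); rewrite str_ofK.
have := leq_trans (leq_npairl x y) (leq_npairr e (npair x y)); lia.
Qed.

Lemma agree_lt_size a s R n : agree a s R n -> n <= size s.
Proof. by case: n => // n /all_iotaP/(_ n (ltnSn n))/output_lt_size. Qed.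

(** If [n] exceeds [N] it is cut down to [N], where the clause [n == size a] of [gain] applies. *)
Lemma gainW a N s s' R n : agree a s' R n -> ~~ agree a s R n ->
  gain (mkseq a N) s s' R.
Proof.
have aE m : m <= N -> agree (nth false (mkseq a N)) ^~ R ^~ m =1 agree a ^~ R ^~ m.
  move=> mN r; apply: eq_in_agree => i ltim; rewrite nth_mkseq//; exact: leq_trans mN.
move=> ag nag; apply/has_iotaP; exists (minn n N); rewrite size_mkseq; first lia.
rewrite !aE ?geq_minr// (agree_le (geq_minl n N) ag) /=.
by case: (ltnP n N) => [ltn|len]; rewrite ?eqxx// nag orbT.
Qed.

Section good_extensions.
Variable A : nat -> bool.
Local Open Scope ring_scope.

(** The sum of the agreement masses over [n < N] is at most [N]. Once it can no longer increase by
    more than [e], the new agreements for all [n < N] together have mass at most [e]. *)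
Lemma settle_agreement s N (e : rat) : 0 < e ->
  exists2 r, prefix s r & forall u, prefix r u ->
    mass u (fun R => has (fun n => agree A u R n && ~~ agree A r R n) (iota 0 N)) <= e.
Proof.
move=> e0.
pose f r := \sum_(0 <= n < N) mass r (agree A r ^~ n).
have fN r : f r <= N%:R.
  have -> : N%:R = \sum_(0 <= n < N) 1 :> rat by rewrite sumr_const_nat subn0.
  by apply: ler_sum => n _; exact: mass_le1.
have [r sr rmax] := near_max s e0 fN; exists r => // u ru.
apply: le_trans (mass_has _ _ (fun n R => agree A u R n && ~~ agree A r R n)) _.
have -> : \sum_(0 <= n < N) mass u (fun R => agree A u R n && ~~ agree A r R n) = f u - f r.
  rewrite -sumrB; apply: eq_bigr => n _; rewrite massD; last first.
    by move=> R; exact: agree_mono.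
  by rewrite (mass_prefix (Q := (agree A r)^~ n) ru) => // R R'; exact: eq_agree.
by rewrite lerBlDl; exact: rmax.
Qed.

(** Only the opposite bit counts as an error, not other numerical outputs. *)
Definition wrong (a : nat -> bool) (r : seq bool) (R : nat -> bool) : bool :=
  has (fun x => output r R x (~~ a x)) (iota 0 (size r)).

Lemma wrongP a r R : reflect (exists x, output r R x (~~ a x)) (wrong a r R).
Proof.
apply: (iffP (has_iotaP _ _)) => [[x _ xr]|[x xr]]; exists x => //.
exact: output_lt_size xr.
Qed.

(** Take [r] over which the error mass is nearly maximal. If no [N] worked, [A x] could be computed
    by searching for a bit output with mass above [2 ^- k] among the [R] not yet wrong over [r]. *)
Lemma noncomputable_agreement s (k : nat) : ~ computable A ->
  exists r N, prefix s r /\ forall u, prefix r u -> mass u (agree A u ^~ N) <= 2 ^- k.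
Proof.
move=> ncA; have e0 : 0 < 2 ^- k :> rat by rewrite invr_gt0 exprn_gt0.
have [r sr rmax] := near_max s e0 (fun r => mass_le1 r (wrong A r)).
exists r; apply: contrapT => noN; apply: ncA.
have {}noN N : exists2 u, prefix r u & 2 ^- k < mass u (agree A u ^~ N).
  apply: contrapT => nu; apply: noN; exists N; split => // u ru.
  by rewrite leNgt; apply/negP => ltu; apply: nu; exists u.
(* Errors over [r] concern arguments below [size r], so this finite table makes the search
   computable. *)
pose a := mkseq A (size r).
have wrongE : wrong (nth false a) r =1 wrong A r.
  by move=> R; apply: eq_in_has => x; rewrite mem_iota => /= ltx; rewrite nth_mkseq.
pose new (u : seq bool) x (b : bool) R := output u R x b && ~~ wrong (nth false a) r R.
(* The bit is the parity of a number because the search ranges over a decodable type; the mass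
   inequality is cleared of denominators. *)
pose Q x (p : seq bool * nat) := prefix r p.1 &&
  (2 ^ size p.1 < cnt (size p.1) (fun q => new p.1 x (odd p.2) (nth false q)) * 2 ^ k)%N.
have QE x p : Q x p = prefix r p.1 && (2 ^- k < mass p.1 (new p.1 x (odd p.2))).
  congr (_ && _); rewrite ltr_pdivlMr ?exprn_gt0// mulrC ltr_pdivrMr ?exprn_gt0//.
  by rewrite -!natrX -natrM ltr_nat.
have cQ : cfun emptyset (fun p => Q p.1 p.2).
  rewrite /Q /new /wrong; cfun_tac; apply: cfun_cnt; cfun_tac.
    by apply: cfun_output; cfun_tac.
  by apply: cfun_output; cfun_tac.
have exQ x : exists p, Q x p.
  (* Agreement below [size r] excludes errors over [r]; agreement below [x.+1] gives the right
     output at [x]. *)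
  have [u ru ltu] := noN (maxn (size r) x.+1); exists (u, A x : nat); rewrite QE ru /= oddb.
  apply: lt_le_trans ltu _; apply: mass_le => R ag; apply/andP; split.
    by move: ag => /all_iotaP; apply; rewrite leq_max ltnSn orbT.
  rewrite wrongE; apply/wrongP => -[y yr].
  have /all_iotaP/(_ y) := agree_le (leq_maxl _ _) ag.
  move=> /(_ (output_lt_size yr)) /(output_functional (output_mono ru yr)).
  by case: (A y).
have [f cf fQ] := cfun_choose cQ exQ.
suff AE : A =1 (fun x => odd (f x).2).
  have [c Pc] : cfun emptyset (fun x => odd (f x).2) by cfun_tac.
  by exists c => x; rewrite AE; exact: Pc.
move=> x; have := fQ x; rewrite QE => /andP[ru lt_new].
case: (eqVneq (A x) (odd (f x).2)) => // neq.
(* An incorrect bit would create new errors of mass above [2 ^- k], against the choice of [r]. *)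
have : mass (f x).1 (new (f x).1 x (odd (f x).2)) <=
    mass (f x).1 (fun R => wrong A (f x).1 R && ~~ wrong A r R).
  apply: mass_le => R /andP[xR]; rewrite wrongE => ->; rewrite andbT; apply/wrongP.
  by exists x; move: xR neq; case: (A x); case: (odd _).
rewrite massD; last by move=> R /wrongP[y yR]; apply/wrongP; exists y; exact: output_mono yR.
rewrite [X in _ - X](_ : _ = mass r (wrong A r)); last first.
  rewrite (mass_prefix ru) => // R R' RR'; apply: eq_has => y; exact: eq_output.
by move=> /(lt_le_trans lt_new); rewrite ltrBrDl ltNge rmax.
Qed.

(** Half of the mass pays for agreement up to [N] itself, the other half for new agreements below
    [N]. The integer form makes a violation decidable. *)
Lemma gain_small s (k : nat) : ~ computable A ->
  exists r N, prefix s r /\ forall u, prefix r u ->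
    (cnt (size u) (fun q => gain (mkseq A N) r u (nth false q)) * 2 ^ k <= 2 ^ size u)%N.
Proof.
move=> /(noncomputable_agreement s k.+1)[r [N [sr rN]]].
have e0 : 0 < 2 ^- k.+1 :> rat by rewrite invr_gt0 exprn_gt0.
have [v rv vmax] := settle_agreement r N e0; exists v, N; split => [|u vu].
  exact: prefix_trans rv.
suff : mass u (gain (mkseq A N) v u) <= 2 ^- k.
  rewrite ler_pdivrMr ?exprn_gt0// mulrC ler_pdivlMr ?exprn_gt0//.
  by rewrite -!natrX -natrM ler_nat.
have -> : 2 ^- k = 2 ^- k.+1 + 2 ^- k.+1 :> rat.
  by rewrite exprS invfM; lra.
apply: le_trans (lerD (rN u (prefix_trans rv vu)) (vmax u vu)).
apply: le_trans (massU _ _ _); apply: mass_le => R /has_iotaP[n].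
rewrite size_mkseq ltnS leq_eqVlt => /predU1P[->|ltn].
  rewrite eqxx andbT /= => ag; apply/orP; left.
  by rewrite -(eq_in_agree (a := nth false (mkseq A N)))// => i lti; rewrite nth_mkseq.
rewrite (ltn_eqF ltn)/= => ag; apply/orP; right; apply/has_iotaP; exists n => //.
move: ag; rewrite !(@eq_in_agree (nth false (mkseq A N)) A)// => i lti;
  by rewrite nth_mkseq//; exact: ltn_trans ltn.
Qed.

End good_extensions.

(** * The tree *)

Section construction.
Variable A : nat -> bool.
Hypothesis A_noncomputable : ~ computable A.
Hypothesis A_le_jump : turing_le A (jump emptyset).
Let X := jump emptyset.

Lemma cfun_A : cfun X A.
Proof. exact: A_le_jump. Qed.

(** A violation of the bound of [gain_small]. The exponent [str_code s] makes the bounds of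
    different strings summable. *)
Definition big_gain (s : seq bool) (p : seq bool * seq bool) (u : seq bool) : bool :=
  prefix p.1 u &&
  (2 ^ size u < cnt (size u) (fun q => gain p.2 p.1 u (nth false q)) * 2 ^ str_code s).

(** The jump can check that the table is an initial segment of [A] and that no violation exists, and
    [gain_small] ensures that the search for such a pair ends. *)
Lemma settling_extension : exists2 f : seq bool -> seq bool, cfun X f &
  forall s, prefix s (f s) /\ exists N, forall u, prefix (f s) u ->
    cnt (size u) (fun q => gain (mkseq A N) (f s) u (nth false q)) * 2 ^ str_code s
      <= 2 ^ size u.
Proof.
pose big (q : seq bool * (seq bool * seq bool)) := `[< exists u, big_gain q.1 q.2 u >].
pose good (s : seq bool) (p : seq bool * seq bool) := [&& prefix s p.1,
  all (fun i => nth false p.2 i == A i) (iota 0 (size p.2)) & ~~ big (s, p)].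
have cA := cfun_A.
have c_big : cfun X big.
  apply: (cfun_exists_jump (Q := fun q => big_gain q.1 q.2)) => Y.
  rewrite /big_gain; cfun_tac; apply: cfun_cnt; cfun_tac.
  by apply: cfun_gain; cfun_tac.
have c_good : cfun X (fun q => good q.1 q.2).
  by rewrite /good; cfun_tac.
have ex_good s : exists p, good s p.
  have [r [N [sr rN]]] := gain_small s (str_code s) A_noncomputable.
  exists (r, mkseq A N); rewrite /good sr /=; apply/andP; split.
    by apply/all_iotaP => i; rewrite size_mkseq => lti; rewrite nth_mkseq.
  by apply/asboolP => -[u /andP[/= /rN]]; rewrite leqNgt => /negbTE->.
have [g cg gP] := cfun_choose c_good ex_good.
exists (fun s => (g s).1); first by cfun_tac.
move=> s; have /and3P[sg /all_iotaP gA /asboolP nbig] := gP s; split => //.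
exists (size (g s).2) => u gu; rewrite leqNgt; apply/negP => gu_big; apply: nbig.
exists u; rewrite /big_gain gu; suff -> : (g s).2 = mkseq A (size (g s).2) by [].
by apply: (@eq_from_nth _ false) => [|i lti]; rewrite ?size_mkseq// nth_mkseq//; exact/eqP/gA.
Qed.

Section tree.
Variable f : seq bool -> seq bool.
Hypothesis f_ext : forall s, prefix s (f s).

Definition node (s : seq bool) : seq bool := foldl (fun t b => f (rcons t b)) (f [::]) s.

(** Nodes are at least as long as their labels, so labels of length [size t] suffice; the search is
    thereby bounded. *)
Definition tree (t : seq bool) : bool :=
  has (fun j => (size (str_of j) == size t) && prefix t (node (str_of j)))
    (iota 0 (2 ^ (size t).+1)).

Lemma node_rcons s b : node (rcons s b) = f (rcons (node s) b).
Proof. exact: foldl_rcons. Qed.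

Lemma prefix_node_rcons s b : prefix (rcons (node s) b) (node (rcons s b)).
Proof. by rewrite node_rcons. Qed.

Lemma prefix_node s r : prefix (node s) (node (s ++ r)).
Proof.
elim/last_ind: r => [|r b IHr]; first by rewrite cats0 prefix_refl.
rewrite -rcons_cat; apply: prefix_trans IHr _.
exact: prefix_trans (prefix_rcons _ _) (prefix_node_rcons _ _).
Qed.

Lemma size_node s : size s <= size (node s).
Proof.
elim/last_ind: s => // s b IHs.
by have := size_prefix (prefix_node_rcons s b); rewrite !size_rcons; exact: leq_ltn_trans.
Qed.

(** Every node is a value of [f], at a string whose code grows with the level; this brings in the
    bounds on gains. *)
Lemma node_f s : exists2 r, size s <= size r & node s = f r.
Proof.
case/lastP: s => [|s b]; first by exists [::].
by exists (rcons (node s) b); rewrite ?node_rcons// !size_rcons ltnS size_node.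
Qed.

Lemma str_code_lt s : (str_code s).+1 < 2 ^ (size s).+1.
Proof.
elim: s => // b s; rewrite str_code_cons [size (b :: s)]/= (expnS _ (size s).+1).
by move: (str_code s) (2 ^ (size s).+1) => k m; case: b => /=; lia.
Qed.

Lemma treeP t : reflect (exists s, prefix t (node s)) (tree t).
Proof.
apply: (iffP (has_iotaP _ _)) => [[j _ /andP[_ tj]]|[s ts]]; first by exists (str_of j).
(* Appending [t] only ensures that the label is long enough to be cut to length [size t]. *)
pose r := take (size t) (s ++ t).
have rt : size r = size t by rewrite size_takel// size_cat leq_addl.
exists (str_code r); first by rewrite -rt; apply: ltn_trans (str_code_lt r); exact: ltnSn.
rewrite str_codeK rt eqxx /=.
have tst : prefix t (node (s ++ t)) by exact: prefix_trans (prefix_node _ _).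
have := prefix_node r (drop (size t) (s ++ t)); rewrite cat_take_drop => rst.
move: tst rst; rewrite !prefixE => /eqP tst /eqP rst.
by rewrite -rst take_takel ?tst// -rt size_node.
Qed.

Lemma tree_perfect : perfect_tree tree.
Proof.
split; first split.
- by apply/treeP; exists [::]; rewrite prefix0s.
- by move=> s t st /treeP[r tr]; apply/treeP; exists r; exact: prefix_trans tr.
move=> s /treeP[r sr]; exists (node (rcons r false)), (node (rcons r true)).
have rb b : prefix s (node (rcons r b)).
  by apply: prefix_trans sr _; rewrite -cats1; exact: prefix_node.
(* The two successors of a node differ at the first position after it. *)
have nthb b u : prefix (node (rcons r b)) u -> nth false u (size (node r)) = b.
  move=> /(prefix_trans (prefix_node_rcons r b)) /prefixP[v ->].
  by rewrite nth_cat size_rcons ltnSn nth_rcons ltnn eqxx.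
split; [by apply/treeP; eexists; exact: prefix_refl..|exact: rb|exact: rb|].
apply/andP; split; apply/negP => pfx.
  by have := nthb _ _ pfx; rewrite (nthb true)// prefix_refl.
by have := nthb _ _ pfx; rewrite (nthb false)// prefix_refl.
Qed.

Lemma tree_computable : cfun X f -> strings_computable_in X tree.
Proof.
move=> cf.
have c_node : cfun X node.
  apply: (eq_cfun (g := fun s => iteri (size s)
    (fun i t => f (rcons t (nth false s i))) (f [::]))) => [s|].
    suff : forall i, i <= size s -> node (take i s) =
        iteri i (fun i t => f (rcons t (nth false s i))) (f [::]).
      by move=> /(_ _ (leqnn _)); rewrite take_size.
    elim=> [|i IHi] lti; first by rewrite take0.
    by rewrite (take_nth false)// node_rcons IHi// ltnW.
  by apply: cfun_iteri; cfun_tac.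
have [c Pc] : cfun X tree by rewrite /tree; cfun_tac.
by exists c.
Qed.

Lemma path_node S k : paths tree S ->
  exists2 s, size s = k & forall j, node (take j s) = mkseq S (size (node (take j s))).
Proof.
(* This length covers all nodes at level [k], so the label found for [mkseq S n] has its first [k]
   levels on [S]. *)
move=> TS; pose n := maxn k (\max_(s <- strs k) size (node s)).
have /treeP[r Sr] := TS n.
(* The label [r] may be shorter than [k], hence the padding. *)
pose s := take k (r ++ nseq k false).
have ks : size s = k by rewrite size_takel// size_cat size_nseq leq_addl.
exists s => // j.
have sn : size (node s) <= n.
  by rewrite leq_max; apply/orP; right; apply: leq_bigmax_seq => //; rewrite mem_strs ks.
have jn : size (node (take j s)) <= n.
  by apply: leq_trans sn; rewrite -{2}(cat_take_drop j s); exact/size_prefix/prefix_node.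
have Sr' : prefix (mkseq S n) (node (r ++ nseq k false)).
  by apply: prefix_trans Sr _; exact: prefix_node.
have jr : prefix (node (take j s)) (node (r ++ nseq k false)).
  rewrite -(cat_take_drop k (r ++ _)) -/s -{2}(cat_take_drop j s) -catA.
  exact: prefix_node.
move: Sr' jr; rewrite !prefixE size_mkseq => /eqP Sr' /eqP jr.
by rewrite -{1}jr -(take_takel _ jn) Sr' /mkseq -map_take take_iota (minn_idPl jn).
Qed.
End tree.
End construction.

(** An agreement too long for any node at level [K] is eventually reached along [S]; the first level
    that reaches it provides the gain. *)
Lemma path_gains (A : nat -> bool) (f : seq bool -> seq bool) S R K :
  (forall s, prefix s (f s)) -> paths (tree f) S ->
  (forall x, exists L, forall s, L <= size s -> s = mkseq S (size s) -> output s R x (A x)) ->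
  exists s b n, [/\ K <= size s, agree A (f (rcons (f s) b)) R n & ~~ agree A (f s) R n].
Proof.
(* By [agree_lt_size], agreement up to [n] requires a string of length at least [n]. *)
move=> f_ext TS SR; pose n := (\max_(s <- strs K) size (node f s)).+1.
have [L Ln] : exists L, forall s, L <= size s -> s = mkseq S (size s) -> agree A s R n.
  elim: n => [|n [L Ln]]; first by exists 0.
  have [M Mn] := SR n; exists (maxn L M) => s; rewrite geq_max => /andP[Ls Ms] sS.
  apply/all_iotaP => x; rewrite ltnS leq_eqVlt => /predU1P[->|]; first exact: Mn.
  by have /all_iotaP := Ln s Ls sS; apply.
have [s sk sS] := path_node f_ext (maxn K L) TS.
have not_at_K r : size r = K -> ~~ agree A (node f r) R n.
  move=> rK; apply/negP => /agree_lt_size; rewrite leqNgt => /negP; apply.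
  by rewrite ltnS; apply: leq_bigmax_seq => //; rewrite mem_strs rK.
pose at_level j := (K <= j) && agree A (node f (take j s)) R n.
have at_s : at_level (size s).
  rewrite /at_level take_size sk leq_maxl /=.
  apply: Ln; last by have := sS (size s); rewrite take_size.
  by apply: leq_trans (size_node f_ext s); rewrite sk leq_maxr.
case: (ex_minnP (ex_intro at_level _ at_s)) => m /andP[Km agm] mmin.
have ltms := mmin _ at_s.
have ltKm : K < m.
  rewrite ltn_neqAle Km andbT; apply/eqP => eK; move: agm.
  by apply/negP/not_at_K; rewrite -eK size_takel// eK.
case: m => // m in agm mmin ltms ltKm {Km} *.
have nagm : ~~ agree A (node f (take m s)) R n.
  by apply/negP => ag; have := mmin m; rewrite ltnn /at_level -ltnS ltKm ag => /(_ isT).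
have [r sr er] := node_f f_ext (take m s); exists r, (nth false s m), n; split.
- by apply: leq_trans sr; rewrite size_takel// ltnW.
- by move: agm; rewrite (take_nth false)// node_rcons er.
- by rewrite -er.
Qed.

Local Open Scope classical_set_scope.
Local Open Scope ring_scope.

(** * The tests *)

Section cylinder_measure.
Variable K : realType.

Lemma measurable_cylinder s : measurable (cylinder s : set cantor).
Proof. by apply: sub_sigma_algebra; exists s. Qed.

Lemma measurable_bigcup_cylinder (W : set (seq bool)) :
  measurable (\bigcup_(s in W) cylinder s : set cantor).
Proof.
rewrite (_ : \bigcup_(_ in _) _ = \bigcup_(j in [set j | W (str_of j)]) cylinder (str_of j)).
  by apply: bigcup_measurable => j _; exact: measurable_cylinder.
apply/seteqP; split => [R [s Ws sR]|R [j Wj jR]]; last by exists (str_of j).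
by exists (str_code s); rewrite /= str_codeK.
Qed.

Lemma uniform_measure_strs n (l : seq (seq bool)) : {in l, forall s, size s = n} ->
  (uniform_measure K (\bigcup_(s in [set` l]) cylinder s) <=
    ((size l)%:R / 2 ^+ n)%:E)%E.
Proof.
elim: l => [|s l IHl] ln.
  by rewrite set_nil bigcup_set0 measure0 mul0r.
have -> : [set` s :: l] = s |` [set` l].
  by apply/seteqP; split=> r /=; rewrite inE => /predU1P.
rewrite bigcup_setU1.
apply: le_trans (measureU2 _ _ _) _.
- exact: measurable_cylinder.
- exact: measurable_bigcup_cylinder.
rewrite /= -[(size l).+1]add1n natrD mulrDl mul1r EFinD leeD//.
  by rewrite uniform_measure_cylinder ln// mem_head.
by apply: IHl => r rl; apply: ln; rewrite inE rl orbT.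
Qed.

End cylinder_measure.

Section test.
Variables (K : realType) (A : nat -> bool) (f : seq bool -> seq bool) (e : nat).
Hypothesis fP : forall s, prefix s (f s) /\ exists N, forall u, prefix (f s) u ->
  (cnt (size u) (fun q => gain (mkseq A N) (f s) u (nth false q)) * 2 ^ str_code s
    <= 2 ^ size u)%N.

Definition prog_str (t : seq bool) : seq bool := iter e (cons true) (false :: t).

Lemma nth_prog_str t i : nth false (prog_str t) i = with_prog e (nth false t) i.
Proof.
rewrite /with_prog /prog_str; elim: e i => [|d IHd] [|i] //=.
by rewrite subn1.
Qed.

(** The length condition makes [prog_str t] as long as the successor [u], so [t] decides agreement
    over both [f s] and [u]. The index [b] ranges over 0 and 1, read as a bit. *)
Definition captured (s t : seq bool) : bool :=
  has (fun b =>
    let u := f (rcons (f s) (odd b)) in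
    (size t + e.+1 == size u)%N &&
    has (fun n => agree A u (nth false (prog_str t)) n &&
                  ~~ agree A (f s) (nth false (prog_str t)) n)
      (iota 0 (size u).+1)) (iota 0 2).

(** Each [s] contributes at most [2 ^ (e + 2 - str_code s)]; summed over codes from [i + e + 3] on,
    this gives [2 ^- i]. *)
Definition test (i : nat) : set cantor :=
  \bigcup_(t in [set t | exists2 s, (i + e + 3 <= str_code s)%N & captured s t]) cylinder t.

Lemma cnt_prog_str m (Q : pred (seq bool)) :
  (cnt m (Q \o prog_str) <= cnt (m + e.+1) Q)%N.
Proof.
rewrite /prog_str; elim: e Q => [|d IHd] Q; rewrite addnS cntS.
  by rewrite addn0 leq_addr.
apply: leq_trans (leq_addl _ _); apply: leq_trans (IHd _).
by rewrite leq_eqVlt; apply/orP; left; apply/eqP/eq_count => t.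
Qed.

(** Removing the block 1^e 0 multiplies measure by [2 ^ e.+1], and the two successors give one more
    factor 2. *)
Lemma captured_measure s :
  (uniform_measure K (\bigcup_(t in [set t | captured s t]) cylinder t) <=
    (2 ^+ e.+2 / 2 ^+ str_code s)%:E)%E.
Proof.
have [fs [N fN]] := fP s.
pose u b := f (rcons (f s) b).
(* The guard empties the list when the subtraction would be truncated. *)
pose l b := [seq t <- strs (size (u b) - e.+1) |
  (e < size (u b))%N && gain (mkseq A N) (f s) (u b) (nth false (prog_str t))].
have l_size b : {in l b, forall t, size t = (size (u b) - e.+1)%N}.
  by move=> t; rewrite mem_filter mem_strs => /andP[_ /eqP].
have l_small b : (uniform_measure K (\bigcup_(t in [set` l b]) cylinder t) <=
    (2 ^+ e.+1 / 2 ^+ str_code s)%:E)%E.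
  apply: le_trans (uniform_measure_strs K (l_size b)) _; rewrite lee_fin.
  have [eu|ue] := ltnP e (size (u b)); last first.
    rewrite /l ltnNge ue /= filter_pred0 mul0r divr_ge0// exprn_ge0//.
  rewrite ler_pdivrMr ?exprn_gt0// mulrAC ler_pdivlMr ?exprn_gt0// -exprD subnKC//.
  rewrite -!natrX -natrM ler_nat.
  have su : prefix (f s) (u b).
    by apply: prefix_trans (prefix_rcons _ b) _; exact: (fP _).1.
  apply: leq_trans (fN _ su); rewrite leq_mul2r; apply/orP; right.
  rewrite /l eu size_filter -[in leqRHS](subnK eu).
  exact: (cnt_prog_str _ (fun q => gain _ _ _ (nth false q))).
have -> : (2 ^+ e.+2 / 2 ^+ str_code s : K) =
    2 ^+ e.+1 / 2 ^+ str_code s + 2 ^+ e.+1 / 2 ^+ str_code s.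
  by rewrite exprS -mulrA mulr_natl mulr2n.
rewrite EFinD; apply: le_trans (leeD (l_small false) (l_small true)).
apply: le_trans (measureU2 _ _ _); rewrite ?inE; do ?exact: measurable_bigcup_cylinder.
apply: le_measure; rewrite ?inE; first exact: measurable_bigcup_cylinder.
  by apply: measurableU; exact: measurable_bigcup_cylinder.
move=> R [t /has_iotaP[b lt2 /andP[/eqP tu /has_iotaP[n _ /andP[ag nag]]]] tR].
have tl : t \in l (odd b).
  rewrite mem_filter mem_strs -/(u _) -tu addnK eqxx andbT; apply/andP; split; first lia.
  exact: gainW ag nag.
by case: (odd b) tl => tl; [right|left]; exists t.
Qed.

Lemma test_measure i : (uniform_measure K (test i) <= (2 ^- i)%:E)%E.
Proof.
pose F j := \bigcup_(t in [set t | captured (str_of (j + (i + e + 3))) t]) cylinder t.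
have := @measure_sigma_subadditive _ _ _ (uniform_measure K) (test i) F
  (fun=> measurable_bigcup_cylinder _) (measurable_bigcup_cylinder _).
move=> /(_ _)/le_trans; apply.
  move=> R [t [s si st] tR]; exists (str_code s - (i + e + 3))%N => //.
  have es : str_of (str_code s - (i + e + 3) + (i + e + 3)) = s.
    by rewrite subnK ?str_codeK.
  by exists t; [rewrite /mkset es|].
have e0 : 0 <= 2 ^- i :> K by rewrite invr_ge0 exprn_ge0.
(* The [j]-th term is at most [2 ^- i / 2 ^ j.+1]. *)
apply: le_trans (epsilon_trick0 xpredT e0); apply: lee_nneseries => [j _ _|j _].
  exact: measure_ge0.
apply: le_trans (captured_measure _) _; rewrite lee_fin str_ofK natrX.
rewrite (_ : (j + (i + e + 3) = j.+1 + i + e.+2)%N); last by lia.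
rewrite exprD invfM mulrCA mulfV ?expf_neq0// mulr1.
by rewrite exprD invfM mulrC.
Qed.

(** [captured] mentions [A] rather than the tables from [fP], so it is decidable from [A] and [f];
    searching for [s] enumerates the test. *)
Lemma test_ce X : cfun X A -> cfun X f -> unif_ce_open X test.
Proof.
move=> cA cf.
pose Q (m : nat) (s : seq bool) :=
  ((npair1 m + e + 3 <= str_code s) && captured s (str_of (npair2 m)))%N.
have c_prog : cfun X prog_str.
  by rewrite /prog_str; elim: e => [|d IHd] /=; cfun_tac.
have cQ : cfun X (fun p : nat * seq bool => Q p.1 p.2).
  rewrite /Q /captured /agree; cfun_tac; apply: cfun_output; cfun_tac.
have [c [c_halts c_sound]] := cfun_mu_code cQ.
exists [set m | exists s, Q m s].
  exists c => m; split => [[s /c_halts]|[y /c_sound]]; first by [].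
  by exists (dec y).
move=> i; congr (\bigcup_(t in _) _); apply/seteqP; split => t /=.
  by move=> [s si st]; exists s; rewrite /Q npair1E npair2E str_codeK si.
by move=> [s]; rewrite /Q npair1E npair2E str_codeK => /andP[]; exists s.
Qed.

End test.

Local Close Scope ring_scope.

Lemma output_with_prog s e R x y : output s (with_prog e R) x y -> e < size s.
Proof.
by move=> /has_iotaP[d ltd /andP[/prog_inj/(_ (prog_with_prog e R)) <-]].
Qed.
Theorem theorem4p1 (K : realType) (A : nat -> bool) :
  ~ computable A -> turing_le A (jump emptyset) ->
  exists T : pred (seq bool),
    [/\ strings_computable_in (jump emptyset) T,
        perfect_tree T &
        forall S : nat -> bool, paths T S ->
        forall R : nat -> bool, two_random K R ->
          ~ turing_le A (join S R)].
Proof.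
move=> ncA leA; have [f cf fP] := settling_extension ncA leA.
have f_ext s : prefix s (f s) := (fP s).1.
exists (tree f); split; [exact: tree_computable|exact: tree_perfect|].
move=> S TS R R2 [c Pc]; pose e := encode c.
apply: (R2 (test A f e)).
  by split; [exact: test_ce|move=> i; exact: test_measure].
move=> i _.
have [s [b [n [si ag nag]]]] := path_gains (A := A) (R := with_prog e R) (i + e + 3)
  f_ext TS (fun x => eval_output (Pc x)).
set u := f _ in ag.
(* Agreement fails over [f s], so [n] is positive and there is an output at 0, which requires the
   whole block to be read. *)
have eu : e < size u.
  case: n ag nag => // n /all_iotaP/(_ 0 isT)/output_with_prog //.
(* The part of [R] readable over [u] once the block is removed. *)
pose t := mkseq R (size u - e.+1).
have tR j : j < size u -> with_prog e R j = nth false (prog_str e t) j.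
  move=> ltj; rewrite nth_prog_str /with_prog; case: (ltnP e j) => //= ej.
  by rewrite nth_mkseq//; lia.
exists t; last by rewrite /cylinder /= size_mkseq.
exists s; first exact: leq_trans si (size_le_str_code s).
have fsu : size (f s) <= size u.
  apply: size_prefix; apply: prefix_trans (prefix_rcons _ b) _; exact: f_ext.
apply/has_iotaP; exists b; first by case: (b).
rewrite (_ : odd b = b) -/u; last by case: (b).
cbv zeta; rewrite size_mkseq subnK//; apply/andP; split => //; apply/has_iotaP; exists n.
  exact: agree_lt_size ag.
rewrite -(eq_agree A n tR) ag /=.
by rewrite -(eq_agree A n (R := with_prog e R))// => j ltj; apply: tR; exact: leq_trans fsu.
Qed.
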